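(* Let $G$ be a quasi-Boolean pro-$2$ group such that $H^\bullet(G,\mathbb F_2)$ is the connected sum of a dual algebra $D^\bullet$ and a graded Boolean algebra $B^\bullet$ associated to the Boolean ring $B$. Let $Y$ be a basis of the $\mathbb F_2$-vector space $D^1$ and let $X$ be the spectrum $\mathrm{Spec}(B)$ of $B$ (with the Zariski topology). Then $G$ is isomorphic to $F(Y)*_2\mathbb B(X)$.
   Context: $H^\bullet(G,\mathbb F_2)$ is the continuous cohomology algebra of $G$. Free pro-$2$ product. For pro-$2$ groups $G_1,G_2$ let $G_1*G_2$ be the discrete free product and let $\mathcal N$ be the family of normal subgroups $N$ of $G_1*G_2$ such that $(G_1*G_2)/N$ is a finite $2$-group and $N\cap G_1$, $N\cap G_2$ are open in $G_1,G_2$ respectively. Then $G_1*_2G_2:=\varprojlim_{N\in\mathcal N}(G_1*G_2)/N$. The group $\mathbb B(X)$. For a topological space $X$ let $\bigstar_X\mathbb Z/2\mathbb Z$ be the group freely generated by the elements of $X$ subject to the relation that these elements are involutions. Let $\mathcal N$ be the family of its normal subgroups $N$ such that $(\bigstar_X\mathbb Z/2\mathbb Z)/N$ is a finite $2$-group and the composite $X\to\bigstar_X\mathbb Z/2\mathbb Z\to(\bigstar_X\mathbb Z/2\mathbb Z)/N$ is continuous for the discrete topology on the target. Then $\mathbb B(X):=\varprojlim_{N\in\mathcal N}(\bigstar_X\mathbb Z/2\mathbb Z)/N$. Free pro-$2$ group $F(Y)$ on a set $Y$ (in the sense of Serre, Galois Cohomology, I.1.5): the projective limit of the quotients $L(Y)/M$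 of the discrete free group $L(Y)$ on $Y$, where $M$ runs over the normal subgroups of $L(Y)$ of index a finite power of $2$ containing all but finitely many elements of $Y$. A free pro-$2$ group is a group isomorphic to some $F(Y)$. A pro-$2$ group is Boolean if it is isomorphic to $\mathbb B(X)$ for some topological space $X$. A pro-$2$ group is quasi-Boolean if it is isomorphic to the free pro-$2$ product of a free pro-$2$ group and a Boolean group. Algebras. A Boolean ring is a (commutative, unital) ring with $x^2=x$ for all $x$ (this includes the zero ring). A graded Boolean algebra associated to a Boolean ring $B$ is the graded $\mathbb F_2$-algebra $B^\bullet=\bigoplus_{i\ge0}B^i$ with $B^0=\mathbb F_2$, $B^i=B$ for every $i\ge1$, and for all $i,j\ge 1$ the multiplication $B^i\times B^j\to B^{i+j}$ equal to the multiplication of $B$. A dual algebra is a graded $\mathbb F_2$-algebra $D^\bullet=\bigoplus_{i\ge0}D^i$ with $D^0=\mathbb F_2$ and $D^i=0$ for $i\ge2$. The connected sum $D^\bullet\sqcap B^\bullet$ is the graded $\mathbb F_2$-algebra with degree $0$ part $\mathbb F_2$, degree $i$ part $D^i\oplus B^i$ for $i\ge1$, and with the products $D^1B^i$ and $B^iD^1$ set to be zero for all $i\ge1$. *)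

(* Defs.v *)
From HB Require Import structures.
From mathcomp Require Import all_boot all_order all_algebra.
From mathcomp Require Import generic_quotient.
From mathcomp Require Import all_classical.
From mathcomp Require Import topology.

Set Implicit Arguments.
Unset Strict Implicit.
Unset Printing Implicit Defensive.

Import GRing.Theory.

Local Open Scope classical_set_scope.
Local Open Scope quotient_scope.
Local Open Scope group_scope.

HB.mixin Record isTopGroup G of Topological G & Group G := {
  mulg_continuous : continuous (fun xy : G * G => (xy.1 * xy.2 : G));
  invg_continuous : continuous (fun x : G => (x^-1 : G))
}.

#[short(type="topGroupType")]
HB.structure Definition TopGroup :=
  {G of Topological G & Group G & isTopGroup G}.

Definition top_isog (G H : topGroupType) : Prop :=
  exists (f : G -> H) (g : H -> G),
    [/\ cancel f g, cancel g f, {morph f : x y / x * y},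
        continuous f & continuous g].

Record nsubgroup (L : groupType) := NSubgroup {
  nsub : set L;
  nsub1 : nsub 1;
  nsubM : forall x y, nsub x -> nsub y -> nsub (x * y);
  nsubV : forall x, nsub x -> nsub x^-1;
  nsubJ : forall x y, nsub x -> nsub (x ^ y)
}.

Section QuotientGroup.
Variables (L : groupType) (N : nsubgroup L).
Implicit Types x y z : L.

Definition gquot_rel x y : bool := `[< nsub N (x^-1 * y) >].

Lemma gquot_rel_equiv : equiv_class_of gquot_rel.
Proof.
split=> [x|x y|y x z].
- by apply/asboolP; rewrite mulVg; exact: nsub1.
- by apply/asboolP/asboolP => /nsubV; rewrite invgM invgK.
- move=> /asboolP xy /asboolP yz; apply/asboolP.
  by rewrite -[z](mulVKg y) mulgA; exact: nsubM.
Qed.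

Canonical gquot_equiv := EquivRelPack gquot_rel_equiv.
Canonical gquot_encModRel := defaultEncModRel gquot_rel.

Definition gquot := {eq_quot gquot_rel}.
HB.instance Definition _ : EqQuotient L gquot_rel gquot := EqQuotient.on gquot.
HB.instance Definition _ := Choice.on gquot.

Definition gquot_pi x : gquot := \pi_gquot x.

Lemma gquot_piP x y : gquot_pi x = gquot_pi y <-> nsub N (x^-1 * y).
Proof.
rewrite /gquot_pi; split=> [/eqP|Nxy]; last apply/eqP.
  by rewrite piE => /asboolP.
by rewrite piE; exact/asboolP.
Qed.

Lemma gquot_reprK (a : gquot) : gquot_pi (repr a) = a.
Proof. exact: reprK. Qed.

Definition gquot_mul (a b : gquot) : gquot := gquot_pi (repr a * repr b).
Definition gquot_inv (a : gquot) : gquot := gquot_pi (repr a)^-1.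

Lemma gquot_mulE x y :
  gquot_mul (gquot_pi x) (gquot_pi y) = gquot_pi (x * y).
Proof.
apply/gquot_piP.
have /gquot_piP Nx := gquot_reprK (gquot_pi x).
have /gquot_piP Ny := gquot_reprK (gquot_pi y).
set x' := repr _ in Nx *; set y' := repr _ in Ny *.
have -> : (x' * y')^-1 * (x * y) = (x'^-1 * x) ^ y' * (y'^-1 * y).
  by rewrite conjgE invgM !mulgA mulgK.
by apply: nsubM => //; exact: nsubJ.
Qed.

Lemma gquot_invE x : gquot_inv (gquot_pi x) = gquot_pi x^-1.
Proof.
apply/gquot_piP.
have /gquot_piP Nx := gquot_reprK (gquot_pi x).
set x' := repr _ in Nx *.
have -> : (x'^-1)^-1 * x^-1 = ((x'^-1 * x)^-1) ^ (x'^-1).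
  by rewrite conjgE invgM !invgK !mulgA mulgK.
by apply: nsubJ; exact: nsubV.
Qed.

Lemma gquot_ind (P : gquot -> Prop) :
  (forall x, P (gquot_pi x)) -> forall a, P a.
Proof. by move=> h a; rewrite -(gquot_reprK a). Qed.

Lemma gquot_mulA : associative gquot_mul.
Proof.
elim/gquot_ind => x; elim/gquot_ind => y; elim/gquot_ind => z.
by rewrite !gquot_mulE mulgA.
Qed.

Lemma gquot_mul1 : left_id (gquot_pi 1) gquot_mul.
Proof. by elim/gquot_ind => x; rewrite gquot_mulE mul1g. Qed.

Lemma gquot_mulr1 : right_id (gquot_pi 1) gquot_mul.
Proof. by elim/gquot_ind => x; rewrite gquot_mulE mulg1. Qed.

Lemma gquot_mulV : left_inverse (gquot_pi 1) gquot_inv gquot_mul.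
Proof. by elim/gquot_ind => x; rewrite gquot_invE gquot_mulE mulVg. Qed.

Lemma gquot_mulrV : right_inverse (gquot_pi 1) gquot_inv gquot_mul.
Proof. by elim/gquot_ind => x; rewrite gquot_invE gquot_mulE mulgV. Qed.

HB.instance Definition _ := isGroup.Build gquot
  gquot_mulA gquot_mul1 gquot_mulr1 gquot_mulV gquot_mulrV.

Lemma gquot_piM x y : gquot_pi (x * y) = gquot_pi x * gquot_pi y.
Proof. exact/esym/gquot_mulE. Qed.

Lemma gquot_piV x : gquot_pi x^-1 = (gquot_pi x)^-1.
Proof. exact/esym/gquot_invE. Qed.

End QuotientGroup.

Definition gquot_map (L : groupType) (M N : nsubgroup L) (a : gquot M) :
  gquot N := gquot_pi N (repr a).

Lemma gquot_map_pi (L : groupType) (M N : nsubgroup L) (x : L) :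
  nsub M `<=` nsub N -> gquot_map N (gquot_pi M x) = gquot_pi N x.
Proof.
move=> MN; apply/gquot_piP/MN.
by have /gquot_piP := gquot_reprK (gquot_pi M x).
Qed.

Definition two_power_index (L : groupType) (N : nsubgroup L) : Prop :=
  exists k : nat, ([set: gquot N] #= `I_(2 ^ k)%N)%card.

Lemma continuous_discreteP (T : topologicalType) (D : choiceType)
    (f : T -> discrete_topology D) :
  continuous f <-> forall d, open (f @^-1` [set d]).
Proof.
split=> [/continuousP fc d|fo]; first by apply: fc; exact: discrete_open.
apply/continuousP => A _.
have -> : f @^-1` A = \bigcup_(d in A) (f @^-1` [set d]).
  by apply/seteqP; split=> [x Ax|x /= [d Ad ->]] //; exists (f x).
by apply: bigcup_open => d _; exact: fo.
Qed.

Lemma continuous_prodP (T : topologicalType) (I : Type)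
    (K : I -> topologicalType) (f : T -> prod_topology K) :
  continuous f <-> forall i, continuous (fun x => f x i).
Proof.
split=> [fc i x|fc x].
  apply: (@continuous_comp _ _ _ f (fun g : prod_topology K => g i)).
    exact: fc.
  have /cvg_sup/(_ i) h : f x --> f x by exact: cvg_id.
  move=> A; rewrite nbhsE => -[B [oB Bfx] BA].
  change (nbhs (f x : prod_topology K) ((fun g : prod_topology K => g i) @^-1` A)).
  apply: h; rewrite nbhsE; exists ((fun g : prod_topology K => g i) @^-1` B).
    by split=> //; exists B.
  by move=> g /= /BA.
apply/cvg_sup => i A [_ [[B oB <-] Bfx BA]].
have fB := fc i x B (open_nbhs_nbhs (conj oB Bfx)).
apply: (@filterS _ (nbhs x) _ (fun y => B (f y i))); last exact: fB.
by move=> y /= By; exact: BA.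
Qed.

Lemma continuous_initialP (T S : topologicalType) (U : choiceType)
    (j : U -> S) (f : T -> initial_topology j) :
  continuous f <-> continuous (fun x => j (f x)).
Proof.
split=> [fc x|/continuousP fc].
  apply: (@continuous_comp _ _ _ f (j : initial_topology j -> S)).
    exact: fc.
  exact: initial_continuous.
by apply/continuousP => _ [B oB <-]; exact: fc.
Qed.

(* The inverse limit of the L / N, N in F, as a subspace of the product of the
   discrete groups L / N. *)
Section Completion.
Variables (L : groupType) (F : set (nsubgroup L)).

Definition gquot_prod := prod_topology (fun N : F => discrete_topology (gquot (val N))).

Definition compatible_family : set gquot_prod :=
  [set x | forall M N : F, nsub (val M) `<=` nsub (val N) ->
     gquot_map (val N) (x M : gquot (val M)) = x N].

Definition completion := set_type compatible_family.
HB.instance Definition _ := Topological.on completion.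

Implicit Types x y z : completion.

Lemma completionP x : compatible_family (val x).
Proof. exact: set_valP. Qed.

Definition coordinate (N : F) x : gquot (val N) := val x N.

Definition mk_completion (f : gquot_prod) (h : compatible_family f) : completion := exist _ f (mem_set h).

Lemma completion_eq x y : (forall N, coordinate N x = coordinate N y) -> x = y.
Proof.
by move=> h; apply/val_inj/functional_extensionality_dep => N; exact: h.
Qed.

Lemma comp_one_subproof : compatible_family (fun N => 1 : gquot (val N)).
Proof. by move=> M N MN; rewrite gquot_map_pi. Qed.

Lemma comp_mul_subproof x y :
  compatible_family (fun N => coordinate N x * coordinate N y : gquot (val N)).
Proof.
move=> M N MN; rewrite /coordinate -(completionP x MN) -(completionP y MN).
elim/gquot_ind: (val x M) => a; elim/gquot_ind: (val y M) => b.
by rewrite -gquot_piM !gquot_map_pi // gquot_piM.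
Qed.

Lemma comp_inv_subproof x :
  compatible_family (fun N => (coordinate N x)^-1 : gquot (val N)).
Proof.
move=> M N MN; rewrite /coordinate -(completionP x MN).
elim/gquot_ind: (val x M) => a.
by rewrite -gquot_piV !gquot_map_pi // gquot_piV.
Qed.

Definition comp_one : completion := mk_completion comp_one_subproof.
Definition comp_mul x y : completion := mk_completion (@comp_mul_subproof x y).
Definition comp_inv x : completion := mk_completion (@comp_inv_subproof x).

Lemma comp_mulA : associative comp_mul.
Proof. by move=> x y z; apply: completion_eq => N; exact: mulgA. Qed.

Lemma comp_mul1 : left_id comp_one comp_mul.
Proof. by move=> x; apply: completion_eq => N; exact: mul1g. Qed.

Lemma comp_mulr1 : right_id comp_one comp_mul.
Proof. by move=> x; apply: completion_eq => N; exact: mulg1. Qed.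

Lemma comp_mulV : left_inverse comp_one comp_inv comp_mul.
Proof. by move=> x; apply: completion_eq => N; exact: mulVg. Qed.

Lemma comp_mulrV : right_inverse comp_one comp_inv comp_mul.
Proof. by move=> x; apply: completion_eq => N; exact: mulgV. Qed.

HB.instance Definition _ := isGroup.Build completion
  comp_mulA comp_mul1 comp_mulr1 comp_mulV comp_mulrV.

Lemma continuous_completionP (T : topologicalType) (f : T -> completion) :
  continuous f <-> forall N, continuous
    (fun t => coordinate N (f t) : discrete_topology (gquot (val N))).
Proof.
rewrite -continuous_prodP.
exact: (@continuous_initialP T gquot_prod completion (val : completion -> gquot_prod) f).
Qed.

Lemma coordinate_continuous N :
  continuous (coordinate N : completion -> discrete_topology (gquot (val N))).
Proof. by move: N; apply/continuous_completionP => x; exact: cvg_id. Qed.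

Lemma open_coordinate (N : F) (a : gquot (val N)) :
  open (coordinate N @^-1` [set a]).
Proof.
by have /continuous_discreteP := @coordinate_continuous N; exact.
Qed.

Lemma comp_mul_continuous :
  continuous (fun xy : completion * completion => (xy.1 * xy.2 : completion)).
Proof.
apply/continuous_completionP => N -[x y] A /=.
rewrite {1}/nbhs /= => /(_ _ erefl) Axy.
exists (coordinate N @^-1` [set coordinate N x], coordinate N @^-1` [set coordinate N y]).
  by split; apply: open_nbhs_nbhs; split=> //; exact: open_coordinate.
move=> [u v] /= [ux vy]; move: Axy; rewrite /= /coordinate /=.
by rewrite -ux -vy.
Qed.

Lemma comp_inv_continuous :
  continuous (fun x : completion => (x^-1 : completion)).
Proof.
apply/continuous_completionP => N x A /=.
rewrite {1}/nbhs /= => /(_ _ erefl) Ax.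
apply: filterS (open_nbhs_nbhs (conj (open_coordinate (coordinate N x)) erefl)).
by move=> u /= ux; move: Ax; rewrite /coordinate /= -/(coordinate N x) -ux.
Qed.

HB.instance Definition _ :=
  isTopGroup.Build completion comp_mul_continuous comp_inv_continuous.

End Completion.

(* The group with generators T and relators R, as words modulo the congruence
   they generate: the letter (t, true) stands for t, (t, false) for t^-1. *)
Section Presentation.
Variables (T : choiceType) (R : set (seq (T * bool))).
Local Notation word := (seq (T * bool)).

Inductive word_cong : word -> word -> Prop :=
| word_cong_refl u : word_cong u u
| word_cong_sym u v : word_cong u v -> word_cong v u
| word_cong_trans u v w : word_cong u v -> word_cong v w -> word_cong u w
| word_cong_cat u u' v v' :
    word_cong u u' -> word_cong v v' -> word_cong (u ++ v) (u' ++ v')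
| word_cong_cancel t b : word_cong [:: (t, b); (t, ~~ b)] [::]
| word_cong_relator r : R r -> word_cong r [::].

Definition word_rel (u v : word) : bool := `[< word_cong u v >].

Lemma word_rel_equiv : equiv_class_of word_rel.
Proof.
split=> [u|u v|v u w].
- exact/asboolP/word_cong_refl.
- by apply/asboolP/asboolP => /word_cong_sym.
- by move=> /asboolP uv /asboolP vw; exact/asboolP/(word_cong_trans uv).
Qed.

Canonical word_equiv := EquivRelPack word_rel_equiv.
Canonical word_encModRel := defaultEncModRel word_rel.

Definition presented := {eq_quot word_rel}.
HB.instance Definition _ : EqQuotient word word_rel presented := EqQuotient.on presented.
HB.instance Definition _ := Choice.on presented.

Definition class_of_word (u : word) : presented := \pi_presented u.
Definition generator (t : T) : presented := class_of_word [:: (t, true)].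

Lemma class_of_wordP u v : class_of_word u = class_of_word v <-> word_cong u v.
Proof.
rewrite /class_of_word; split=> [/eqP|Nxy]; last apply/eqP.
  by rewrite piE => /asboolP.
by rewrite piE; exact/asboolP.
Qed.

Lemma presented_ind (P : presented -> Prop) :
  (forall u, P (class_of_word u)) -> forall a, P a.
Proof. by move=> h a; rewrite -[a]reprK; exact: h. Qed.

Definition inv_word (u : word) : word := rev [seq (p.1, ~~ p.2) | p <- u].

Definition pres_mul (a b : presented) := class_of_word (repr a ++ repr b).
Definition pres_inv (a : presented) := class_of_word (inv_word (repr a)).

Lemma inv_word_cat u v : inv_word (u ++ v) = inv_word v ++ inv_word u.
Proof. by rewrite /inv_word map_cat rev_cat. Qed.

Lemma inv_wordK : involutive inv_word.
Proof.
move=> u; rewrite /inv_word map_rev revK -map_comp -[RHS]map_id.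
by apply: eq_map => -[t b] /=; rewrite negbK.
Qed.

Lemma word_cong_mulV u : word_cong (u ++ inv_word u) [::].
Proof.
elim: u => [|[t b] u IH]; first exact: word_cong_refl.
rewrite -cat1s inv_word_cat -catA (catA u).
apply: word_cong_trans (word_cong_cancel t b).
apply: (word_cong_cat (word_cong_refl [:: (t, b)])).
exact: (word_cong_cat IH (word_cong_refl _)).
Qed.

Lemma word_cong_mulVr u : word_cong (inv_word u ++ u) [::].
Proof. by have := word_cong_mulV (inv_word u); rewrite inv_wordK. Qed.

Lemma word_cong_inv u v : word_cong u v -> word_cong (inv_word u) (inv_word v).
Proof.
move=> uv; rewrite -[inv_word u]cats0.
apply: (word_cong_trans (v := inv_word u ++ (v ++ inv_word v))).
  exact: (word_cong_cat (word_cong_refl _) (word_cong_sym (word_cong_mulV v))).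
rewrite catA -[X in word_cong _ X]cat0s.
apply: word_cong_cat; last exact: word_cong_refl.
apply: word_cong_trans (word_cong_mulVr u).
exact: (word_cong_cat (word_cong_refl _) (word_cong_sym uv)).
Qed.

Lemma pres_mulE u v :
  pres_mul (class_of_word u) (class_of_word v) = class_of_word (u ++ v).
Proof.
by apply/class_of_wordP/word_cong_cat; apply/class_of_wordP; exact: reprK.
Qed.

Lemma pres_invE u : pres_inv (class_of_word u) = class_of_word (inv_word u).
Proof.
by apply/class_of_wordP/word_cong_inv/class_of_wordP; exact: reprK.
Qed.

Lemma pres_mulA : associative pres_mul.
Proof.
elim/presented_ind => u; elim/presented_ind => v; elim/presented_ind => w.
by rewrite !pres_mulE catA.
Qed.

Lemma pres_mul1 : left_id (class_of_word [::]) pres_mul.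
Proof. by elim/presented_ind => u; rewrite pres_mulE. Qed.

Lemma pres_mulr1 : right_id (class_of_word [::]) pres_mul.
Proof. by elim/presented_ind => u; rewrite pres_mulE cats0. Qed.

Lemma pres_mulV : left_inverse (class_of_word [::]) pres_inv pres_mul.
Proof.
elim/presented_ind => u; rewrite pres_invE pres_mulE.
exact/class_of_wordP/word_cong_mulVr.
Qed.

Lemma pres_mulrV : right_inverse (class_of_word [::]) pres_inv pres_mul.
Proof.
elim/presented_ind => u; rewrite pres_invE pres_mulE.
exact/class_of_wordP/word_cong_mulV.
Qed.

HB.instance Definition _ := isGroup.Build presented
  pres_mulA pres_mul1 pres_mulr1 pres_mulV pres_mulrV.

End Presentation.

Definition free_group (Y : choiceType) : groupType :=
  presented (@set0 (seq (Y * bool))).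

Definition free_pro2 (Y : choiceType) : topGroupType :=
  completion [set N : nsubgroup (free_group Y) | two_power_index N /\
    finite_set [set y : Y | ~ nsub N (generator set0 y)]].

Definition involution_relators (X : choiceType) : set (seq (X * bool)) :=
  [set [:: (x, true); (x, true)] | x in [set: X]].

(* The group written as a star indexed by X of copies of Z/2Z. *)
Definition involution_group (X : choiceType) : groupType :=
  presented (@involution_relators X).

Definition boolean_pro2 (X : topologicalType) : topGroupType :=
  completion [set N : nsubgroup (involution_group X) | two_power_index N /\
    continuous (fun x : X =>
      gquot_pi N (generator (@involution_relators X) x)
        : discrete_topology (gquot N))].

Definition free_product_relators (G1 G2 : groupType) :
    set (seq ((G1 + G2)%type * bool)) :=
  [set [:: (inl a, true); (inl b, true); (inl (a * b), false)]
     | a in [set: G1] & b in [set: G1]] `|`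
  [set [:: (inr a, true); (inr b, true); (inr (a * b), false)]
     | a in [set: G2] & b in [set: G2]].

Definition free_product (G1 G2 : groupType) : groupType :=
  presented (@free_product_relators G1 G2).

Definition free_product_inl (G1 G2 : groupType) (a : G1) :
  free_product G1 G2 := generator (@free_product_relators G1 G2) (inl a).

Definition free_product_inr (G1 G2 : groupType) (a : G2) :
  free_product G1 G2 := generator (@free_product_relators G1 G2) (inr a).

(* The preimage of N under the canonical map Gi -> G1 * G2, which is injective,
   is the intersection of N with Gi. *)
Definition free_pro2_product (G1 G2 : topGroupType) : topGroupType :=
  completion [set N : nsubgroup (free_product G1 G2) |
    [/\ two_power_index N, open (@free_product_inl G1 G2 @^-1` nsub N) &
        open (@free_product_inr G1 G2 @^-1` nsub N)]].

Definition pro2_group (G : topGroupType) : Prop :=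
  [/\ compact [set: G], hausdorff_space G, totally_disconnected [set: G] &
      forall N : nsubgroup G, open (nsub N) -> two_power_index N].

Definition is_free_pro2 (G : topGroupType) : Prop :=
  exists Y : choiceType, top_isog G (free_pro2 Y).

Definition is_boolean (G : topGroupType) : Prop :=
  pro2_group G /\ exists X : topologicalType, top_isog G (boolean_pro2 X).

Definition is_quasi_boolean (G : topGroupType) : Prop :=
  pro2_group G /\ exists F B : topGroupType,
    [/\ is_free_pro2 F, is_boolean B & top_isog G (free_pro2_product F B)].

Local Close Scope group_scope.
Local Open Scope ring_scope.

(* Graded F_2-algebras, given by their homogeneous components. The equations
   between elements of A (i + (j + k)) and A (i + j + k), etc., are stated in
   the total space {n : nat & A n}. *)
Record gradedAlg := GradedAlg {
  gcomp :> nat -> lmodType 'F_2;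
  gone : gcomp 0;
  gmul : forall i j, gcomp i -> gcomp j -> gcomp (i + j);
  gmulDl : forall i j (x y : gcomp i) (z : gcomp j),
    gmul (x + y) z = gmul x z + gmul y z;
  gmulDr : forall i j (x : gcomp i) (y z : gcomp j),
    gmul x (y + z) = gmul x y + gmul x z;
  gmulZl : forall i j (a : 'F_2) (x : gcomp i) (y : gcomp j),
    gmul (a *: x) y = a *: gmul x y;
  gmulZr : forall i j (a : 'F_2) (x : gcomp i) (y : gcomp j),
    gmul x (a *: y) = a *: gmul x y;
  gmulA : forall i j k (x : gcomp i) (y : gcomp j) (z : gcomp k),
    Tagged gcomp (gmul x (gmul y z)) = Tagged gcomp (gmul (gmul x y) z);
  gmul1l : forall i (x : gcomp i), Tagged gcomp (gmul gone x) = Tagged gcomp x;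
  gmul1r : forall i (x : gcomp i), Tagged gcomp (gmul x gone) = Tagged gcomp x
}.

Arguments gone {g}.
Arguments gmul {g i j} x y.

Definition graded_iso (A B : gradedAlg) : Prop :=
  exists f : forall i, {linear A i -> B i},
    [/\ forall i, bijective (f i), f 0%N gone = gone &
        forall i j (x : A i) (y : A j), f (i + j)%N (gmul x y) = gmul (f i x) (f j y)].

(* The positive-degree part of a connected graded algebra: pcomp i is the
   component of degree i + 1, whence the index of the target of pmul. *)
Record posGradedAlg := PosGradedAlg {
  pcomp :> nat -> lmodType 'F_2;
  pmul : forall i j, pcomp i -> pcomp j -> pcomp (i + j.+1);
  pmulDl : forall i j (x y : pcomp i) (z : pcomp j),
    pmul (x + y) z = pmul x z + pmul y z;
  pmulDr : forall i j (x : pcomp i) (y z : pcomp j),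
    pmul x (y + z) = pmul x y + pmul x z;
  pmulZl : forall i j (a : 'F_2) (x : pcomp i) (y : pcomp j),
    pmul (a *: x) y = a *: pmul x y;
  pmulZr : forall i j (a : 'F_2) (x : pcomp i) (y : pcomp j),
    pmul x (a *: y) = a *: pmul x y;
  pmulA : forall i j k (x : pcomp i) (y : pcomp j) (z : pcomp k),
    Tagged pcomp (pmul x (pmul y z)) = Tagged pcomp (pmul (pmul x y) z)
}.

Arguments pmul {p i j} x y.

(* Adjunction of F_2 in degree 0, with 1 in F_2 as the unit. *)
Section Connected.
Variable P : posGradedAlg.

Definition conn_comp (n : nat) : lmodType 'F_2 :=
  if n is m.+1 then P m else ('F_2)^o.

Definition conn_one : conn_comp 0 := (1 : 'F_2).

Definition conn_cast m n (e : m = n) (x : conn_comp m) : conn_comp n :=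
  ecast n (conn_comp n) e x.

Definition conn_mul (i j : nat) :
    conn_comp i -> conn_comp j -> conn_comp (i + j) :=
  match i, j return conn_comp i -> conn_comp j -> conn_comp (i + j) with
  | 0, _ => fun a y => a *: y
  | i'.+1, 0 => fun x a => conn_cast (esym (addn0 i'.+1)) (a *: x)
  | i'.+1, j'.+1 => fun x y => pmul x y
  end.

Lemma conn_castE m n (e : m = n) (x : conn_comp m) :
  Tagged conn_comp (conn_cast e x) = Tagged conn_comp x.
Proof. by case: _ / e. Qed.

Lemma conn_castD m n (e : m = n) (x y : conn_comp m) :
  conn_cast e (x + y) = conn_cast e x + conn_cast e y.
Proof. by case: _ / e. Qed.

Lemma conn_castZ m n (e : m = n) a (x : conn_comp m) :
  conn_cast e (a *: x) = a *: conn_cast e x.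
Proof. by case: _ / e. Qed.

Lemma Tagged_conn_inj n (x y : conn_comp n) :
  Tagged conn_comp x = Tagged conn_comp y -> x = y.
Proof. exact: eq_from_Tagged. Qed.

Lemma conn_mulDl i j (x y : conn_comp i) (z : conn_comp j) :
  conn_mul (x + y) z = conn_mul x z + conn_mul y z.
Proof.
case: i x y => [|i] x y; first exact: scalerDl.
by case: j z => [|j] z; rewrite /= ?scalerDr ?conn_castD ?pmulDl.
Qed.

Lemma conn_mulDr i j (x : conn_comp i) (y z : conn_comp j) :
  conn_mul x (y + z) = conn_mul x y + conn_mul x z.
Proof.
case: i x => [|i] x; first exact: scalerDr.
by case: j y z => [|j] y z; rewrite /= ?scalerDl ?conn_castD ?pmulDr.
Qed.

Lemma conn_mulZl i j (a : 'F_2) (x : conn_comp i) (y : conn_comp j) :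
  conn_mul (a *: x) y = a *: conn_mul x y.
Proof.
case: i x => [|i] x; first by rewrite /= scalerA.
case: j y => [|j] y; rewrite /= ?pmulZl //.
by rewrite scalerA mulrC -scalerA conn_castZ.
Qed.

Lemma conn_mulZr i j (a : 'F_2) (x : conn_comp i) (y : conn_comp j) :
  conn_mul x (a *: y) = a *: conn_mul x y.
Proof.
case: i x => [|i] x; first by rewrite /= !scalerA mulrC.
case: j y => [|j] y; rewrite /= ?pmulZr //.
by rewrite -scalerA conn_castZ.
Qed.

Lemma conn_mul_cast i j k l (e : i = k) (f : j = l) (x : conn_comp i) (y : conn_comp j) :
  Tagged conn_comp (conn_mul (conn_cast e x) (conn_cast f y)) =
  Tagged conn_comp (conn_mul x y).
Proof. by case: _ / e; case: _ / f. Qed.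

Lemma conn_mulA i j k (x : conn_comp i) (y : conn_comp j) (z : conn_comp k) :
  Tagged conn_comp (conn_mul x (conn_mul y z)) =
  Tagged conn_comp (conn_mul (conn_mul x y) z).
Proof.
case: i x => [|i] x; first by rewrite [conn_mul x _]/= -conn_mulZl.
case: j y => [|j] y.
  rewrite [conn_mul y z]/= conn_mulZr [conn_mul x y]/=.
  by rewrite -[z in RHS]/(conn_cast erefl z) conn_mul_cast conn_mulZl.
case: k z => [|k] z.
  rewrite [conn_mul y z]/= [RHS]/= conn_castE.
  rewrite -[x in LHS]/(conn_cast erefl x) conn_mul_cast conn_mulZr.
  by [].
have /= e := pmulA x y z.
set u := pmul x _ in e *.
have h (p : {n : nat & P n}) (q : {n : nat & P n}) : p = q ->
    Tagged conn_comp (tagged p : conn_comp (tag p).+1) =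
    Tagged conn_comp (tagged q : conn_comp (tag q).+1) by move=> ->.
exact: h e.
Qed.

Lemma conn_mul1l i (x : conn_comp i) :
  Tagged conn_comp (conn_mul conn_one x) = Tagged conn_comp x.
Proof. by rewrite /= scale1r. Qed.

Lemma conn_mul1r i (x : conn_comp i) :
  Tagged conn_comp (conn_mul x conn_one) = Tagged conn_comp x.
Proof.
case: i x => [|i] x; last by rewrite /= conn_castE scale1r.
by congr Tagged; exact: mulr1.
Qed.

Definition connected_alg : gradedAlg :=
  @GradedAlg conn_comp conn_one conn_mul conn_mulDl conn_mulDr
    conn_mulZl conn_mulZr conn_mulA conn_mul1l conn_mul1r.

End Connected.

(* The product in positive degrees is componentwise on D i * B i; in particular
   the products of elements of D by elements of B vanish. *)
Section ConnectedSum.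
Variables D B : gradedAlg.

Definition csum_comp (i : nat) : lmodType 'F_2 := (D i.+1 * B i.+1)%type.

Definition csum_mul i j (x : csum_comp i) (y : csum_comp j) :
  csum_comp (i + j.+1) := (gmul x.1 y.1, gmul x.2 y.2).

Lemma csum_mulDl i j (x y : csum_comp i) (z : csum_comp j) :
  csum_mul (x + y) z = csum_mul x z + csum_mul y z.
Proof. by rewrite /csum_mul !gmulDl. Qed.

Lemma csum_mulDr i j (x : csum_comp i) (y z : csum_comp j) :
  csum_mul x (y + z) = csum_mul x y + csum_mul x z.
Proof. by rewrite /csum_mul !gmulDr. Qed.

Lemma csum_mulZl i j (a : 'F_2) (x : csum_comp i) (y : csum_comp j) :
  csum_mul (a *: x) y = a *: csum_mul x y.
Proof. by rewrite /csum_mul !gmulZl. Qed.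

Lemma csum_mulZr i j (a : 'F_2) (x : csum_comp i) (y : csum_comp j) :
  csum_mul x (a *: y) = a *: csum_mul x y.
Proof. by rewrite /csum_mul !gmulZr. Qed.

Lemma csum_mulA i j k (x : csum_comp i) (y : csum_comp j) (z : csum_comp k) :
  Tagged csum_comp (csum_mul x (csum_mul y z)) =
  Tagged csum_comp (csum_mul (csum_mul x y) z).
Proof.
have e : (i + (j + k.+1).+1)%N = (i + j.+1 + k.+1)%N by rewrite -addSn addnA.
have h m n (u : csum_comp m) (v : csum_comp n) : m = n ->
    Tagged (gcomp D) u.1 = Tagged (gcomp D) v.1 ->
    Tagged (gcomp B) u.2 = Tagged (gcomp B) v.2 ->
    Tagged csum_comp u = Tagged csum_comp v.
  move=> emn; case: _ / emn v => v e1 e2; congr Tagged.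
  rewrite [u]surjective_pairing [v]surjective_pairing.
  by rewrite (eq_from_Tagged e1) (eq_from_Tagged e2).
apply: (h _ _ _ _ e); first exact: (gmulA x.1 y.1 z.1).
exact: (gmulA x.2 y.2 z.2).
Qed.

Definition connected_sum : gradedAlg := connected_alg
  (PosGradedAlg csum_mulDl csum_mulDr csum_mulZl csum_mulZr csum_mulA).

End ConnectedSum.

Definition dual_alg (D : gradedAlg) : Prop :=
  bijective (fun a : 'F_2 => a *: (gone : D 0%N)) /\
  forall i, (2 <= i)%N -> forall x : D i, x = 0.

HB.mixin Record isBooleanRing R of GRing.ComPzRing R := {
  mulbb : forall x : R, x * x = x
}.

#[short(type="booleanRingType")]
HB.structure Definition BooleanRing := {R of isBooleanRing R & GRing.ComPzRing R}.

(* A Boolean ring has characteristic 2, hence is an F_2-vector space. *)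
Section BooleanModule.
Variable B : booleanRingType.

Lemma boolean_ring_addxx (x : B) : x + x = 0.
Proof.
have := mulbb (x + x); rewrite mulrDl !mulrDr !mulbb.
by move=> /eqP; rewrite -subr_eq0 addrK => /eqP.
Qed.

Definition boolean_module : Type := B.
HB.instance Definition _ := GRing.Zmodule.on boolean_module.

Definition boolean_scale (a : 'F_2) (x : boolean_module) : boolean_module :=
  x *+ a.

Lemma boolean_mulrn_mod (x : B) n : x *+ (n %% 2) = x *+ n.
Proof.
by rewrite {2}(divn_eq n 2) mulrnDr mulnC mulrnA mulr2n boolean_ring_addxx
  mul0rn add0r.
Qed.

Lemma boolean_scaleA a b x :
  boolean_scale a (boolean_scale b x) = boolean_scale (a * b) x.
Proof.
by rewrite /boolean_scale -mulrnA mulnC -(boolean_mulrn_mod x (a * b)).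
Qed.

Lemma boolean_scale1 : left_id 1 boolean_scale.
Proof. by move=> x; rewrite /boolean_scale. Qed.

Lemma boolean_scaleDr : right_distributive boolean_scale +%R.
Proof. by move=> a x y; exact: mulrnDl. Qed.

Lemma boolean_scaleDl x : {morph boolean_scale^~ x : a b / a + b}.
Proof.
by move=> a b; rewrite /boolean_scale -mulrnDr -(boolean_mulrn_mod x (a + b)%N).
Qed.

HB.instance Definition _ := GRing.Zmodule_isLmodule.Build 'F_2 boolean_module
  boolean_scaleA boolean_scale1 boolean_scaleDr boolean_scaleDl.

Definition gbool_comp (i : nat) : lmodType 'F_2 := boolean_module.

Definition gbool_mul i j (x : gbool_comp i) (y : gbool_comp j) :
  gbool_comp (i + j.+1) := (x : B) * (y : B).

Lemma gbool_mulDl i j (x y : gbool_comp i) (z : gbool_comp j) :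
  gbool_mul (x + y) z = gbool_mul x z + gbool_mul y z.
Proof. exact: mulrDl. Qed.

Lemma gbool_mulDr i j (x : gbool_comp i) (y z : gbool_comp j) :
  gbool_mul x (y + z) = gbool_mul x y + gbool_mul x z.
Proof. exact: mulrDr. Qed.

Lemma gbool_mulZl i j (a : 'F_2) (x : gbool_comp i) (y : gbool_comp j) :
  gbool_mul (a *: x) y = a *: gbool_mul x y.
Proof. exact: mulrnAl. Qed.

Lemma gbool_mulZr i j (a : 'F_2) (x : gbool_comp i) (y : gbool_comp j) :
  gbool_mul x (a *: y) = a *: gbool_mul x y.
Proof. exact: mulrnAr. Qed.

Lemma gbool_mulA i j k (x : gbool_comp i) (y : gbool_comp j) (z : gbool_comp k) :
  Tagged gbool_comp (gbool_mul x (gbool_mul y z)) =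
  Tagged gbool_comp (gbool_mul (gbool_mul x y) z).
Proof.
rewrite /gbool_mul mulrA; move: (_ * _) => u.
have e : (i + (j + k.+1).+1)%N = (i + j.+1 + k.+1)%N by rewrite -addSn addnA.
exact: (congr1 (fun n => existT gbool_comp n u) e).
Qed.

Definition graded_boolean : gradedAlg := connected_alg
  (PosGradedAlg gbool_mulDl gbool_mulDr gbool_mulZl gbool_mulZr gbool_mulA).

End BooleanModule.

Definition is_basis (K : fieldType) (V : lmodType K) (Y : set V) : Prop :=
  (forall (s : seq V) (c : V -> K), uniq s -> [set` s] `<=` Y ->
     \sum_(y <- s) c y *: y = 0 -> forall y, y \in s -> c y = 0) /\
  (forall v : V, exists (s : seq V) (c : V -> K),
     [set` s] `<=` Y /\ v = \sum_(y <- s) c y *: y).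

(* Prime ideals, with the Zariski topology. The zero ring has none. *)
Section Spectrum.
Variable B : comPzRingType.

Record spectrum := Spectrum {
  prime_set : set B;
  prime0 : prime_set 0;
  primeD : forall x y, prime_set x -> prime_set y -> prime_set (x + y);
  primeM : forall x y, prime_set y -> prime_set (x * y);
  prime1 : ~ prime_set 1;
  prime_prime : forall x y, prime_set (x * y) -> prime_set x \/ prime_set y
}.

HB.instance Definition _ := gen_eqMixin spectrum.
HB.instance Definition _ := gen_choiceMixin spectrum.

Definition zero_locus (E : set B) : set spectrum :=
  [set p | E `<=` prime_set p].

Definition zariski_open : set_system spectrum := [set ~` zero_locus E | E in [set: set B]].

Lemma zariski_openT : zariski_open setT.
Proof.
exists [set 1] => //; apply/seteqP; split=> // p _ /(_ 1 erefl).
exact: prime1.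
Qed.

Lemma zariski_openI : setI_closed zariski_open.
Proof.
move=> _ _ [E _ <-] [E' _ <-].
exists [set z | exists x y, [/\ E x, E' y & z = x * y]] => //.
apply/seteqP; split=> [p nEE'|p [nE nE'] h].
  split=> h; apply: nEE' => _ [x [y [Ex Ey ->]]].
    by rewrite mulrC; apply/primeM/h.
  exact/primeM/h.
have [x Ex npx] : exists2 x, E x & ~ prime_set p x.
  by apply: contrapT => h'; apply: nE => x Ex; apply: contrapT => ?; apply: h'; exists x.
have [y Ey npy] : exists2 y, E' y & ~ prime_set p y.
  by apply: contrapT => h'; apply: nE' => y Ey; apply: contrapT => ?; apply: h'; exists y.
by case: (@prime_prime p x y) => //; apply: h; exists x, y.
Qed.

Lemma zariski_open_bigcup (I : Type) (U : I -> set spectrum) :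
  (forall i, zariski_open (U i)) -> zariski_open (\bigcup_i U i).
Proof.
move=> oU; exists [set x | exists i E, ~` zero_locus E = U i /\ E x] => //.
apply/seteqP; split=> [p np|p [i _]].
  apply: contrapT => h; apply: np => x [i [E [hE Ex]]].
  apply: contrapT => npx; apply: h; exists i => //.
  by rewrite -hE => /(_ x Ex).
have [E _ hE] := oU i; rewrite -hE => np h.
by apply: np => x Ex; apply: h; exists i, E.
Qed.

HB.instance Definition _ := isOpenTopological.Build spectrum
  zariski_openT zariski_openI zariski_open_bigcup.

End Spectrum.

Record submodule (R : nzRingType) (V : lmodType R) := Submodule {
  subm : set V;
  subm0 : subm 0;
  submD : forall x y, subm x -> subm y -> subm (x + y);
  submZ : forall a x, subm x -> subm (a *: x)
}.

Section QuotientModule.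
Variables (R : nzRingType) (V : lmodType R) (W : submodule V).
Implicit Types x y z : V.

Definition mquot_rel x y : bool := `[< subm W (x - y) >].

Lemma submN x : subm W x -> subm W (- x).
Proof. by rewrite -scaleN1r; exact: submZ. Qed.

Lemma mquot_rel_equiv : equiv_class_of mquot_rel.
Proof.
split=> [x|x y|y x z].
- by apply/asboolP; rewrite subrr; exact: subm0.
- by apply/asboolP/asboolP => /submN; rewrite opprB.
- move=> /asboolP xy /asboolP yz; apply/asboolP.
  by rewrite -(subrK y x) -addrA; exact: submD.
Qed.

Canonical mquot_equiv := EquivRelPack mquot_rel_equiv.
Canonical mquot_encModRel := defaultEncModRel mquot_rel.

Definition mquot := {eq_quot mquot_rel}.
HB.instance Definition _ : EqQuotient V mquot_rel mquot := EqQuotient.on mquot.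
HB.instance Definition _ := Choice.on mquot.

Definition mquot_pi x : mquot := \pi_mquot x.

Lemma mquot_piP x y : mquot_pi x = mquot_pi y <-> subm W (x - y).
Proof.
rewrite /mquot_pi; split=> [/eqP|Wxy]; last apply/eqP.
  by rewrite piE => /asboolP.
by rewrite piE; exact/asboolP.
Qed.

Lemma mquot_reprK (a : mquot) : mquot_pi (repr a) = a.
Proof. exact: reprK. Qed.

Lemma mquot_ind (P : mquot -> Prop) :
  (forall x, P (mquot_pi x)) -> forall a, P a.
Proof. by move=> h a; rewrite -(mquot_reprK a). Qed.

Definition mquot_add (a b : mquot) : mquot := mquot_pi (repr a + repr b).
Definition mquot_opp (a : mquot) : mquot := mquot_pi (- repr a).
Definition mquot_scale (k : R) (a : mquot) : mquot := mquot_pi (k *: repr a).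

Lemma mquot_addE x y :
  mquot_add (mquot_pi x) (mquot_pi y) = mquot_pi (x + y).
Proof.
apply/mquot_piP; rewrite opprD addrACA.
by apply: submD; apply/mquot_piP; exact: mquot_reprK.
Qed.

Lemma mquot_oppE x : mquot_opp (mquot_pi x) = mquot_pi (- x).
Proof.
by apply/mquot_piP; rewrite -opprD; apply/submN/mquot_piP/mquot_reprK.
Qed.

Lemma mquot_scaleE k x : mquot_scale k (mquot_pi x) = mquot_pi (k *: x).
Proof.
by apply/mquot_piP; rewrite -scalerBr; apply/submZ/mquot_piP/mquot_reprK.
Qed.

Lemma mquot_addA : associative mquot_add.
Proof.
elim/mquot_ind => x; elim/mquot_ind => y; elim/mquot_ind => z.
by rewrite !mquot_addE addrA.
Qed.

Lemma mquot_addC : commutative mquot_add.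
Proof.
by elim/mquot_ind => x; elim/mquot_ind => y; rewrite !mquot_addE addrC.
Qed.

Lemma mquot_add0 : left_id (mquot_pi 0) mquot_add.
Proof. by elim/mquot_ind => x; rewrite mquot_addE add0r. Qed.

Lemma mquot_addN : left_inverse (mquot_pi 0) mquot_opp mquot_add.
Proof. by elim/mquot_ind => x; rewrite mquot_oppE mquot_addE addNr. Qed.

HB.instance Definition _ := GRing.isZmodule.Build mquot
  mquot_addA mquot_addC mquot_add0 mquot_addN.

Lemma mquot_piD x y : mquot_pi (x + y) = mquot_pi x + mquot_pi y.
Proof. exact/esym/mquot_addE. Qed.

Lemma mquot_scaleA k l a :
  mquot_scale k (mquot_scale l a) = mquot_scale (k * l) a.
Proof. by elim/mquot_ind: a => x; rewrite !mquot_scaleE scalerA. Qed.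

Lemma mquot_scale1 : left_id 1 mquot_scale.
Proof. by elim/mquot_ind => x; rewrite mquot_scaleE scale1r. Qed.

Lemma mquot_scaleDr : right_distributive mquot_scale +%R.
Proof.
move=> k; elim/mquot_ind => x; elim/mquot_ind => y.
by rewrite -mquot_piD !mquot_scaleE -mquot_piD scalerDr.
Qed.

Lemma mquot_scaleDl a : {morph mquot_scale^~ a : k l / k + l}.
Proof.
move=> k l; elim/mquot_ind: a => x.
by rewrite !mquot_scaleE -mquot_piD scalerDl.
Qed.

HB.instance Definition _ := GRing.Zmodule_isLmodule.Build R mquot
  mquot_scaleA mquot_scale1 mquot_scaleDr mquot_scaleDl.

Lemma mquot_piZ k x : mquot_pi (k *: x) = k *: mquot_pi x.
Proof. exact/esym/mquot_scaleE. Qed.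

End QuotientModule.

Lemma continuous_discrete_op (T : topologicalType) (A B C : choiceType)
    (op : A -> B -> C) (f : T -> discrete_topology A)
    (g : T -> discrete_topology B) :
  continuous f -> continuous g ->
  continuous (fun t => op (f t) (g t) : discrete_topology C).
Proof.
move=> /continuous_discreteP fc /continuous_discreteP gc.
apply/continuous_discreteP => c.
have -> : (fun t => op (f t) (g t) : discrete_topology C) @^-1` [set c] =
    \bigcup_(p in [set p | op p.1 p.2 = c])
      (f @^-1` [set p.1] `&` g @^-1` [set p.2]).
  apply/seteqP; split=> [t /= <-|t [[a b] /= <- [-> ->]]] //.
  by exists (f t, g t).
by apply: bigcup_open => p _; exact: openI.
Qed.

(* Continuous inhomogeneous cochains of G with coefficients in the discrete
   trivial module F_2. *)
Section Cochains.
Variable G : topGroupType.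

Definition gpow (n : nat) : topologicalType := prod_topology (fun _ : 'I_n => G).

Definition cochain (n : nat) : lmodType 'F_2 := (gpow n -> ('F_2)^o)%type.

Definition continuous_cochain n (f : cochain n) : Prop :=
  continuous (f : gpow n -> discrete_topology 'F_2).

(* From (g_1, ..., g_(n+1)): face 0 drops g_1, face i (0 < i <= n) replaces
   g_i, g_(i+1) by their product, and face (n + 1) drops g_(n+1). *)
Definition face n (i : nat) (g : gpow n.+1) : gpow n := fun j : 'I_n =>
  if (j.+1 < i)%N then g (widen_ord (leqnSn n) j)
  else if (j.+1 == i)%N then (g (widen_ord (leqnSn n) j) * g (lift ord0 j))%g
  else g (lift ord0 j).

(* The usual signs (-1)^i are equal to 1 in F_2. *)
Definition differential n (f : cochain n) : cochain n.+1 :=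
  fun g => \sum_(i < n.+2) f (face i g).

Definition is_coboundary n : set (cochain n) :=
  match n with
  | 0 => [set 0]
  | m.+1 => [set differential c | c in @continuous_cochain m]
  end.

Lemma differentialD n (f h : cochain n) :
  differential (f + h) = differential f + differential h.
Proof.
apply/funext => g; rewrite /differential.
by rewrite -[RHS]/(_ + _) -big_split; exact: eq_bigr.
Qed.

Lemma differentialZ n a (f : cochain n) :
  differential (a *: f) = a *: differential f.
Proof.
apply/funext => g; rewrite /differential.
by rewrite -[RHS]/(_ *: _) scaler_sumr; exact: eq_bigr.
Qed.

Lemma differential0 n : differential (0 : cochain n) = 0.
Proof. by rewrite -[X in differential X](scale0r 0) differentialZ scale0r. Qed.

Lemma continuous_cochainD n (f h : cochain n) :
  continuous_cochain f -> continuous_cochain h -> continuous_cochain (f + h).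
Proof. exact: (@continuous_discrete_op _ _ _ _ (fun a b : 'F_2 => a + b)). Qed.

Lemma continuous_cochain_cst n (a : 'F_2) :
  continuous_cochain ((fun=> a) : cochain n).
Proof. exact: cst_continuous. Qed.

Lemma continuous_cochainZ n a (f : cochain n) :
  continuous_cochain f -> continuous_cochain (a *: f).
Proof.
move=> fc; apply: (@continuous_discrete_op _ _ _ _ (fun x y : 'F_2 => x * y) (fun=> a) f) => //.
exact: (@continuous_cochain_cst n a).
Qed.

Definition is_cocycle n : {pred cochain n} :=
  fun f => `[< continuous_cochain f /\ differential f = 0 >].

Lemma cocycle_submod n : submod_closed (@is_cocycle n).
Proof.
split.
  by apply/asboolP; split; [exact: continuous_cochain_cst|exact: differential0].
move=> a f h /asboolP[fc df] /asboolP[hc dh]; apply/asboolP; split.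
  by apply: continuous_cochainD => //; exact: continuous_cochainZ.
by rewrite differentialD differentialZ df dh scaler0 addr0.
Qed.

HB.instance Definition _ n :=
  GRing.isSubmodClosed.Build 'F_2 (cochain n) (@is_cocycle n) (@cocycle_submod n).

Record cocycle n := Cocycle {
  cocycle_val :> cochain n;
  cocycle_valP : cocycle_val \in @is_cocycle n
}.

HB.instance Definition _ n := [isSub for @cocycle_val n].
HB.instance Definition _ n := [Choice of cocycle n by <:].
HB.instance Definition _ n := [SubChoice_isSubLmodule of cocycle n by <:].

Lemma cocycleP n (z : cocycle n) :
  continuous_cochain z /\ differential z = 0.
Proof. by have /asboolP := cocycle_valP z. Qed.

Lemma coboundary0 n : is_coboundary (0 : cochain n).
Proof.
by case: n => [//|n]; exists 0; [exact: continuous_cochain_cst|exact: differential0].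
Qed.

Lemma coboundaryD n (f h : cochain n) :
  is_coboundary f -> is_coboundary h -> is_coboundary (f + h).
Proof.
case: n f h => [|n] f h /=; first by move=> -> ->; rewrite addr0.
move=> [b bc <-] [c cc <-]; exists (b + c); last exact: differentialD.
exact: continuous_cochainD.
Qed.

Lemma coboundaryZ n a (f : cochain n) :
  is_coboundary f -> is_coboundary (a *: f).
Proof.
case: n f => [|n] f /=; first by move=> ->; rewrite scaler0.
move=> [b bc <-]; exists (a *: b); last exact: differentialZ.
exact: continuous_cochainZ.
Qed.

Definition coboundaries n : submodule (cocycle n) :=
  @Submodule _ (cocycle n) [set z | is_coboundary (val z)]
    (@coboundary0 n) (fun x y => @coboundaryD n (val x) (val y))
    (fun a x => @coboundaryZ n a (val x)).

Definition cohomology n : lmodType 'F_2 := mquot (coboundaries n).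

Definition cup_cochain m n (f : cochain m) (h : cochain n) : cochain (m + n) :=
  fun g => f (fun i => g (lshift n i)) * h (fun j => g (rshift m j)).

Definition cast_cochain m n (e : m = n) (f : cochain m) : cochain n :=
  fun g => f (fun i => g (cast_ord e i)).

Lemma cast_cochain_id m (e : m = m) (f : cochain m) : cast_cochain e f = f.
Proof.
apply/funext => g; congr f; apply/funext => i; congr g; exact: val_inj.
Qed.

Let prefix n (s : nat -> G) : gpow n := fun i => s i.
Local Arguments prefix n s : clear implicits.
Let nface i (s : nat -> G) (j : nat) : G :=
  if (j.+1 < i)%N then s j
  else if (j.+1 == i)%N then (s j * s j.+1)%g else s j.+1.

Let prefix_ex n (g : gpow n) : exists s, g = prefix n s.
Proof.
exists (fun k => if insub k is Some i then g i else 1%g).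
by apply/funext => i; rewrite /prefix valK.
Qed.

Let face_prefix n i s : face i (prefix n.+1 s) = prefix n (nface i s).
Proof. by apply/funext => j; rewrite /face /prefix /nface /= /bump /=. Qed.

Let F2_addxx (x : 'F_2) : x + x = 0.
Proof. by rewrite -mulr2n -mulr_natr (_ : 2%:R = 0 :> 'F_2) ?mulr0 //; exact/val_inj. Qed.

Lemma differential_cup m n (f : cochain m) (h : cochain n) :
  differential (cup_cochain f h) =
  cup_cochain (differential f) h +
  cast_cochain (addnS m n) (cup_cochain f (differential h)).
Proof.
apply/funext => g; have [s ->] := prefix_ex g.
transitivity (differential f (prefix m.+1 s) *
    h (prefix n (fun k => s (m.+1 + k)%N)) +
  f (prefix m s) * differential h (prefix n.+1 (fun k => s (m + k)%N))); last by [].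
rewrite /differential.
under eq_bigr do rewrite face_prefix.
rewrite mulr_suml mulr_sumr.
under [X in _ = X + _]eq_bigr do rewrite face_prefix.
under [X in _ = _ + X]eq_bigr do rewrite face_prefix.
rewrite [X in _ = X + _]big_ord_recr [X in _ = _ + X]big_ord_recl /=.
have -> : prefix m (nface m.+1 s) = prefix m s.
  by apply/funext => j; rewrite /prefix /nface ltnS ltn_ord.
have -> : prefix n (nface 0 (fun k => s (m + k)%N)) =
    prefix n (fun k => s (m.+1 + k)%N).
  by apply/funext => j; rewrite /prefix /nface /= addnS addSn.
rewrite -[RHS]addrA [X in _ = _ + X]addrA F2_addxx add0r.
pose F i := f (prefix m (nface i s)) *
  h (prefix n (fun k => nface i s (m + k)%N)).
rewrite -[LHS](big_mkord xpredT F) (@big_cat_nat _ _ _ m.+1) //=; last first.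
  by rewrite ltnS -addnS leq_addr.
congr (_ + _).
  rewrite big_mkord; apply: eq_bigr => i _; congr (_ * h _).
  apply/funext => j; rewrite /prefix /nface addSn.
  have ij : (i < (m + j).+1)%N by rewrite (leq_trans (ltn_ord i)) // ltnS leq_addr.
  by rewrite ltnNge (ltnW ij) /= gtn_eqF.
rewrite -{1}[m.+1]add0n big_addn -addnS subSS addKn big_mkord.
apply: eq_bigr => i _; rewrite /F; congr (f _ * h _).
  apply/funext => j; rewrite /prefix /nface.
  by rewrite (_ : _ < _)%N //= addnS ltnS (leq_trans (ltn_ord j)) // leq_addl.
apply/funext => j; rewrite /prefix /nface /= /bump /= add1n.
have -> : ((m + j).+1 < i + m.+1)%N = (j.+1 < i.+1)%N.
  by rewrite addnS !ltnS addnC ltn_add2r.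
have -> : ((m + j).+1 == i + m.+1)%N = (j.+1 == i.+1)%N.
  by rewrite [RHS]eqSS addnS eqSS addnC eqn_add2r.
by rewrite -addnS.
Qed.

Lemma continuous_cup m n (f : cochain m) (h : cochain n) :
  continuous_cochain f -> continuous_cochain h ->
  continuous_cochain (cup_cochain f h).
Proof.
have pc (T : topologicalType) k (p : T -> gpow k) :
    (forall i, continuous (fun t => p t i)) -> continuous p.
  by move=> ?; apply/continuous_prodP.
have coord k i : continuous (fun g : gpow k => g i).
  by move: i; apply/continuous_prodP => x; exact: cvg_id.
move=> fc hc; apply: (@continuous_discrete_op (gpow (m + n)) _ _ _ (fun x y : 'F_2 => x * y)).
  move=> g; apply: (@continuous_comp _ _ _ (fun g : gpow (m + n) => (fun i => g (lshift n i)) : gpow m)).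
    by apply: pc => i; exact: coord.
  exact: fc.
move=> g; apply: (@continuous_comp _ _ _ (fun g : gpow (m + n) => (fun i => g (rshift m i)) : gpow n)).
  by apply: pc => i; exact: coord.
exact: hc.
Qed.


Lemma cup_cochainDl m n (f1 f2 : cochain m) (h : cochain n) :
  cup_cochain (f1 + f2) h = cup_cochain f1 h + cup_cochain f2 h.
Proof. by apply/funext => g; exact: mulrDl. Qed.

Lemma cup_cochainDr m n (f : cochain m) (h1 h2 : cochain n) :
  cup_cochain f (h1 + h2) = cup_cochain f h1 + cup_cochain f h2.
Proof. by apply/funext => g; exact: mulrDr. Qed.

Lemma cup_cochainZl m n a (f : cochain m) (h : cochain n) :
  cup_cochain (a *: f) h = a *: cup_cochain f h.
Proof. by apply/funext => g; exact/esym/mulrA. Qed.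

Lemma cup_cochainZr m n a (f : cochain m) (h : cochain n) :
  cup_cochain f (a *: h) = a *: cup_cochain f h.
Proof. by apply/funext => g; exact: mulrCA. Qed.

Lemma cup_cochain0l m n (h : cochain n) : cup_cochain (0 : cochain m) h = 0.
Proof. by apply/funext => g; exact: mul0r. Qed.

Lemma cup_cochain0r m n (f : cochain m) : cup_cochain f (0 : cochain n) = 0.
Proof. by apply/funext => g; exact: mulr0. Qed.

Lemma cast_cochain0 m n (e : m = n) : cast_cochain e 0 = 0.
Proof. by apply/funext. Qed.

Lemma coboundary_cast m n (e : m = n) (f : cochain m) :
  is_coboundary f -> is_coboundary (cast_cochain e f).
Proof. by case: _ / e; rewrite cast_cochain_id. Qed.

Lemma cup_cocycle_subproof m n (f : cocycle m) (h : cocycle n) :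
  cup_cochain f h \in @is_cocycle (m + n).
Proof.
have [fc df] := cocycleP f; have [hc dh] := cocycleP h; apply/asboolP.
split; first exact: continuous_cup.
by rewrite differential_cup df dh cup_cochain0l cup_cochain0r cast_cochain0 addr0.
Qed.

Definition cup_cocycle m n (f : cocycle m) (h : cocycle n) : cocycle (m + n) :=
  Cocycle (cup_cocycle_subproof f h).

Lemma coboundary_cupl m n (f : cocycle m) (h : cocycle n) :
  is_coboundary (val f) -> is_coboundary (val (cup_cocycle f h)).
Proof.
have [hc dh] := cocycleP h; case: f => /= f _.
case: m f => [|m] f /=; first by move=> ->; rewrite cup_cochain0l; exact: coboundary0.
move=> [c cc <-]; exists (cup_cochain c h); first exact: continuous_cup.
by rewrite differential_cup dh cup_cochain0r cast_cochain0 addr0.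
Qed.

Lemma coboundary_cupr m n (f : cocycle m) (h : cocycle n) :
  is_coboundary (val h) -> is_coboundary (val (cup_cocycle f h)).
Proof.
have [fc df] := cocycleP f; case: h => /= h _.
case: n h => [|n] h /=; first by move=> ->; rewrite cup_cochain0r; exact: coboundary0.
move=> [c cc <-].
have := differential_cup f c; rewrite df cup_cochain0l add0r => e.
have b : @is_coboundary (m + n).+1 (differential (cup_cochain f c)).
  by exists (cup_cochain f c) => //; exact: continuous_cup.
have := coboundary_cast (esym (addnS m n)) b; rewrite e.
congr is_coboundary; apply/funext => g; rewrite /cast_cochain.
by congr cup_cochain; apply/funext => i; congr g; exact: val_inj.
Qed.

Definition cohomology_class n (z : cocycle n) : cohomology n :=
  mquot_pi (coboundaries n) z.

Definition cup m n (a : cohomology m) (b : cohomology n) : cohomology (m + n) :=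
  cohomology_class (cup_cocycle (repr a) (repr b)).

Lemma cupE m n (f : cocycle m) (h : cocycle n) :
  cup (cohomology_class f) (cohomology_class h) =
  cohomology_class (cup_cocycle f h).
Proof.
rewrite /cup; set f' := repr _; set h' := repr _.
have /mquot_piP/= ff' : cohomology_class f' = cohomology_class f.
  exact: mquot_reprK.
have /mquot_piP/= hh' : cohomology_class h' = cohomology_class h.
  exact: mquot_reprK.
apply/mquot_piP => /=.
have -> : cup_cochain f' h' - cup_cochain f h =
    val (cup_cocycle (f' - f) h') + val (cup_cocycle f (h' - h)).
  apply/funext => g; rewrite /= /cup_cochain.
  rewrite -[LHS]/(_ * _ - _ * _) -[RHS]/((_ - _) * _ + _ * (_ - _)).
  by rewrite mulrBl mulrBr addrA subrK.
by apply: coboundaryD; [exact: coboundary_cupl|exact: coboundary_cupr].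
Qed.

Lemma cohomology_ind n (P : cohomology n -> Prop) :
  (forall z, P (cohomology_class z)) -> forall a, P a.
Proof. exact: mquot_ind. Qed.

Lemma cohomology_classD n (x y : cocycle n) :
  cohomology_class (x + y) = cohomology_class x + cohomology_class y.
Proof. exact: mquot_piD. Qed.

Lemma cohomology_classZ n a (x : cocycle n) :
  cohomology_class (a *: x) = a *: cohomology_class x.
Proof. exact: mquot_piZ. Qed.

Lemma cupDl m n (a b : cohomology m) (c : cohomology n) :
  cup (a + b) c = cup a c + cup b c.
Proof.
elim/cohomology_ind: a => f1; elim/cohomology_ind: b => f2.
elim/cohomology_ind: c => h.
rewrite -cohomology_classD !cupE -cohomology_classD; congr cohomology_class.
by apply: val_inj; exact: cup_cochainDl.
Qed.

Lemma cupDr m n (a : cohomology m) (b c : cohomology n) :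
  cup a (b + c) = cup a b + cup a c.
Proof.
elim/cohomology_ind: a => f; elim/cohomology_ind: b => h1.
elim/cohomology_ind: c => h2.
rewrite -cohomology_classD !cupE -cohomology_classD; congr cohomology_class.
by apply: val_inj; exact: cup_cochainDr.
Qed.

Lemma cupZl m n k (a : cohomology m) (b : cohomology n) :
  cup (k *: a) b = k *: cup a b.
Proof.
elim/cohomology_ind: a => f; elim/cohomology_ind: b => h.
rewrite -cohomology_classZ !cupE -cohomology_classZ; congr cohomology_class.
by apply: val_inj; exact: cup_cochainZl.
Qed.

Lemma cupZr m n k (a : cohomology m) (b : cohomology n) :
  cup a (k *: b) = k *: cup a b.
Proof.
elim/cohomology_ind: a => f; elim/cohomology_ind: b => h.
rewrite -cohomology_classZ !cupE -cohomology_classZ; congr cohomology_class.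
by apply: val_inj; exact: cup_cochainZr.
Qed.

Lemma Tagged_cohomology m n (e : m = n) (f : cocycle m) (h : cocycle n) :
  cast_cochain e f = h ->
  Tagged cohomology (cohomology_class f) = Tagged cohomology (cohomology_class h).
Proof.
case: _ / e h => h; rewrite cast_cochain_id => fh.
by have -> : f = h by exact: val_inj.
Qed.

Lemma cupA m n p (a : cohomology m) (b : cohomology n) (c : cohomology p) :
  Tagged cohomology (cup a (cup b c)) = Tagged cohomology (cup (cup a b) c).
Proof.
elim/cohomology_ind: a => f; elim/cohomology_ind: b => h.
elim/cohomology_ind: c => k; rewrite !cupE.
apply: (Tagged_cohomology (e := addnA m n p)); apply/funext => g.
rewrite /= /cast_cochain /cup_cochain /= mulrA; congr (_ * _); [congr (_ * _)|].
- by congr (f : cochain m); apply/funext => i; congr g; exact: val_inj.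
- by congr (h : cochain n); apply/funext => i; congr g; exact: val_inj.
- congr (k : cochain p); apply/funext => i; congr g; apply: val_inj => /=.
  by rewrite addnA.
Qed.

Lemma one_cocycle_subproof : ((fun=> 1) : cochain 0) \in @is_cocycle 0.
Proof.
apply/asboolP; split; first exact: continuous_cochain_cst.
by apply/funext => g; rewrite /differential !big_ord_recl big_ord0 addr0 F2_addxx.
Qed.

Definition cohomology_one : cohomology 0 :=
  cohomology_class (Cocycle one_cocycle_subproof).

Lemma cup1l n (a : cohomology n) :
  Tagged cohomology (cup cohomology_one a) = Tagged cohomology a.
Proof.
elim/cohomology_ind: a => f; rewrite cupE.
apply: (Tagged_cohomology (e := add0n n)); apply/funext => g.
rewrite /= /cast_cochain /cup_cochain /= mul1r.
by congr (f : cochain n); apply/funext => i; congr g; exact: val_inj.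
Qed.

Lemma cup1r n (a : cohomology n) :
  Tagged cohomology (cup a cohomology_one) = Tagged cohomology a.
Proof.
elim/cohomology_ind: a => f; rewrite cupE.
apply: (Tagged_cohomology (e := addn0 n)); apply/funext => g.
rewrite /= /cast_cochain /cup_cochain /= mulr1.
by congr (f : cochain n); apply/funext => i; congr g; exact: val_inj.
Qed.

Definition cohomology_alg : gradedAlg :=
  @GradedAlg cohomology cohomology_one cup cupDl cupDr cupZl cupZr
    cupA cup1l cup1r.

End Cochains.

(* Main.v *)
Require Import Defs.
From mathcomp Require Import all_boot all_order all_algebra.
From mathcomp Require Import fingroup pgroup abelian.
From mathcomp Require Import ring generic_quotient.
From mathcomp Require Import all_classical topology.
From HB Require Import structures.

(* The group F(Y) *_2 B(X) is characterised by a universal property: a continuous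
   homomorphism to a finite 2-group P is the same as a map Y -> P with finite
   support together with a continuous map from X to the involutions of P (and 1).
   In particular only the Boolean ring C(X, F_2) matters, and X may be replaced
   by its spectrum.

   If G has this property for (Y', X'), then H^1(G) consists of the pairs of a
   finitely supported function on Y' and a continuous function on X'. A class
   whose square vanishes is zero on X', as one sees by evaluating a cochain at
   the involutions of G; conversely, lifting homomorphisms to a central extension
   of F_2^3 by F_2 shows that a u b = c u c as soon as c = ab on X'. Hence the
   algebra H(G) recovers C(X', F_2) as B, and D^1 as the kernel of the squaring
   map, i.e. as the space of finitely supported functions on Y'. So Y and Y' are
   in bijection, being bases of the same space. *)

Set Implicit Arguments.
Unset Strict Implicit.
Unset Printing Implicit Defensive.

Import GRing.Theory.

Local Open Scope classical_set_scope.
Local Open Scope group_scope.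

(** * Finite 2-groups *)

Definition two_group (P : groupType) : Prop :=
  exists k : nat, ([set: P] #= `I_(2 ^ k)%N)%card.

Section FiniteGroupType.
Variables (P : groupType) (n : nat) (f : P -> 'I_n) (g : 'I_n -> P).
Hypothesis fK : cancel f g.

(** These structures turn a bare group with an injection into an ordinal into a [finGroupType], so
    that the theory of exponents and p-groups applies. *)
Definition count_type_of : countType :=
  HB.pack_for countType P (CanIsCountable fK).

Definition fin_type_of : finType :=
  HB.pack_for finType P (@CanIsFinite count_type_of 'I_n f g fK) count_type_of.

Definition fin_group_of : finGroupType :=
  HB.pack_for finGroupType P fin_type_of P.

End FiniteGroupType.

Lemma card_ordinalP (T : Type) n : ([set: T] #= `I_n)%card ->
  exists (f : T -> 'I_n) (g : 'I_n -> T), cancel f g /\ cancel g f.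
Proof.
move=> /card_set_bijP[f [fn fi fs]].
have fP x : (f x < n)%N by exact: fn.
have /choice[g gP] (i : 'I_n) : exists x, f x = i.
  by have [x _ <-] := fs i (ltn_ord i); exists x.
exists (fun x => Ordinal (fP x)), g; split=> [x|i]; last exact/val_inj/gP.
by apply: fi; rewrite ?inE ?gP.
Qed.

Lemma ordinal_card (T : Type) n (f : T -> 'I_n) (g : 'I_n -> T) :
  cancel f g -> cancel g f -> ([set: T] #= `I_n)%card.
Proof.
move=> fK gK; apply/card_set_bijP; exists (fun x => val (f x)); split.
- by move=> x _ /=; exact: ltn_ord.
- by move=> x y _ _ /val_inj; exact: can_inj.
- by move=> i /= ilt; exists (g (Ordinal ilt)); rewrite ?gK.
Qed.

(** The exponent of a finite group divides its order and has the same prime divisors. The criterion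
    by exponents passes easily to groups embedded in a product. *)
Lemma two_groupP (P : groupType) : two_group P <->
  finite_set [set: P] /\ exists k, forall x : P, x ^+ (2 ^ k)%N = 1.
Proof.
split=> [[k Pk]|[/finite_setP[n Pn] [k xk]]].
  split; first by apply/finite_setP; exists (2 ^ k)%N.
  have [f [g [fK gK]]] := card_ordinalP Pk.
  exists k => x; pose Q := fin_group_of fK.
  have cQ : #|[set: Q]%SET| = (2 ^ k)%N.
    by rewrite cardsT -[RHS]card_ord; exact: (@bij_eq_card Q _ f (Bijective fK gK)).
  have /exponentP eQ : exponent [set: Q]%SET %| (2 ^ k)%N.
    by rewrite -cQ; exact: exponent_dvdn.
exact: eQ (finset.in_setT (x : Q)).
have [f [g [fK gK]]] := card_ordinalP Pn.
pose Q := fin_group_of fK.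
have cQ : #|[set: Q]%SET| = n.
  by rewrite cardsT -[RHS]card_ord; exact: (@bij_eq_card Q _ f (Bijective fK gK)).
have /p_natP[m nE] : 2.-nat n.
  rewrite -cQ -[_.-nat _]/(2.-group [set: Q]%SET) -pnat_exponent.
  apply: pnat_dvd (_ : _ %| 2 ^ k)%N _; last by rewrite pnatX pnat_id.
  by apply/exponentP => x _; exact: xk.
by exists m; rewrite -nE.
Qed.

(** * Homomorphisms, kernels and quotients by normal subgroups *)

Section Morphisms.
Variables (L P : groupType) (f : L -> P).
Hypothesis fM : {morph f : x y / x * y}.

Lemma morph_one : f 1 = 1.
Proof. by apply: (mulgI (f 1)); rewrite -fM !mulg1. Qed.

Lemma morph_inv x : f x^-1 = (f x)^-1.
Proof. by apply: (mulgI (f x)); rewrite -fM !mulgV morph_one. Qed.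

Lemma morph_exp x n : f (x ^+ n) = f x ^+ n.
Proof. by elim: n => [|n IH]; rewrite ?expg0 ?morph_one // !expgS fM IH. Qed.

Definition kernel : nsubgroup L.
Proof.
exists [set x | f x = 1] => [|x y /= fx fy|x /= fx|x y /= fx].
- exact: morph_one.
- by rewrite fM fx fy mulg1.
- by rewrite morph_inv fx invg1.
- by rewrite conjgE !fM fx mul1g -fM mulVg morph_one.
Defined.

Lemma gquot_pi_kernelP x y :
  gquot_pi kernel x = gquot_pi kernel y <-> f x = f y.
Proof.
rewrite gquot_piP /= fM morph_inv; split=> [e|->]; last by rewrite mulVg.
by rewrite -[RHS](mulKVg (f x)) e mulg1.
Qed.

Section Factor.
Variable N : nsubgroup L.
Hypothesis Nf : forall x, nsub N x -> f x = 1.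

(** The hypothesis [Nf] makes the value independent of the representative. *)
Definition gquot_lift (a : gquot N) : P := f (repr a).

Lemma gquot_lift_pi x : gquot_lift (gquot_pi N x) = f x.
Proof.
have /gquot_piP/Nf := gquot_reprK (gquot_pi N x).
rewrite fM morph_inv => e.
by rewrite -[RHS](mulKVg (f (repr (gquot_pi N x)))) e mulg1.
Qed.

Lemma gquot_liftM : {morph gquot_lift : a b / a * b}.
Proof.
elim/gquot_ind => x; elim/gquot_ind => y.
by rewrite -gquot_piM !gquot_lift_pi fM.
Qed.

End Factor.

Lemma gquot_lift_kernel_inj : injective (@gquot_lift kernel).
Proof.
elim/gquot_ind => x; elim/gquot_ind => y.
by rewrite !gquot_lift_pi // => /gquot_pi_kernelP.
Qed.

End Morphisms.

(** The pair of maps embeds [Q] into the product of [P1] and [P2]; this makes [Q] finite and bounds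
    its exponent by the product of the two bounds. *)
Lemma two_group_jointly_injective (Q P1 P2 : groupType)
    (f1 : Q -> P1) (f2 : Q -> P2) :
  {morph f1 : x y / x * y} -> {morph f2 : x y / x * y} ->
  (forall x y, f1 x = f1 y -> f2 x = f2 y -> x = y) ->
  two_group P1 -> two_group P2 -> two_group Q.
Proof.
move=> f1M f2M inj /two_groupP[fin1 [k1 e1]] /two_groupP[fin2 [k2 e2]].
apply/two_groupP; split.
  rewrite -[setT]/((fun x => (f1 x, f2 x)) @^-1` setT) -setXTT.
  apply: finite_preimage; last exact: finite_setX.
  by move=> x y _ _ [] /inj.
exists (k1 + k2)%N => x; apply: inj.
  by rewrite (morph_exp f1M) expnD expgnA e1 expg1n morph_one.
by rewrite (morph_exp f2M) addnC expnD expgnA e2 expg1n morph_one.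
Qed.

Lemma two_group_inj (Q P : groupType) (f : Q -> P) :
  {morph f : x y / x * y} -> injective f -> two_group P -> two_group Q.
Proof.
move=> fM fi tP; apply: (two_group_jointly_injective fM fM _ tP tP) => x y.
by move=> /fi.
Qed.

Lemma two_power_index_kernel (L P : groupType) (f : L -> P)
    (fM : {morph f : x y / x * y}) :
  two_group P -> two_power_index (kernel fM).
Proof.
apply: (two_group_inj (gquot_liftM fM (N := kernel fM) _)) => //.
exact: gquot_lift_kernel_inj.
Qed.

Section Intersection.
Variables (L : groupType) (M N : nsubgroup L).

Definition nsubI : nsubgroup L.
Proof.
exists (nsub M `&` nsub N) => [|x y [? ?] [? ?]|x [? ?]|x y [? ?]].
- by split; exact: nsub1.
- by split; exact: nsubM.
- by split; exact: nsubV.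
- by split; exact: nsubJ.
Defined.

(** The quotient by the intersection embeds into the product of the quotients by [M] and by [N]. *)
Lemma two_power_indexI :
  two_power_index M -> two_power_index N -> two_power_index nsubI.
Proof.
have piM (K : nsubgroup L) : {morph gquot_pi K : x y / x * y}.
  exact: gquot_piM.
have ker K x : nsub K x -> gquot_pi K x = 1.
  by move=> Kx; apply/esym/gquot_piP; rewrite invg1 mul1g.
have hM x : nsub nsubI x -> gquot_pi M x = 1 by move=> [] /ker.
have hN x : nsub nsubI x -> gquot_pi N x = 1 by move=> [] _ /ker.
apply: (two_group_jointly_injective (gquot_liftM (piM M) hM)
  (gquot_liftM (piM N) hN)).
elim/gquot_ind => x; elim/gquot_ind => y.
rewrite !(gquot_lift_pi (piM M) hM) !(gquot_lift_pi (piM N) hN).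
by move=> /gquot_piP ? /gquot_piP ?; apply/gquot_piP.
Qed.

End Intersection.

Definition nsubT (L : groupType) : nsubgroup L := 
  @NSubgroup L setT I (fun _ _ _ _ => I) (fun _ _ => I) (fun _ _ _ => I).

Lemma two_power_indexT (L : groupType) : two_power_index (nsubT L).
Proof.
exists 0%N; apply: (@ordinal_card _ 1 (fun=> ord0) (fun=> 1)) => x.
  by elim/gquot_ind: x => x; apply/gquot_piP.
by rewrite [x]ord1.
Qed.

(** * Completions *)

Section CompletionTheory.
Variables (L : groupType) (F : set (nsubgroup L)).

Definition completion_of (x : L) : completion F :=
  @mk_completion L F (fun N => gquot_pi (val N) x)
    (fun M N MN => gquot_map_pi x MN).

Lemma completion_ofM : {morph completion_of : x y / x * y}.
Proof. by move=> x y; apply: completion_eq => N; exact: gquot_piM. Qed.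

Lemma coordinateM (N : F) : {morph @coordinate L F N : x y / x * y}.
Proof. by []. Qed.

Lemma coordinate_sub (M N : F) (x y : completion F) :
  nsub (val M) `<=` nsub (val N) ->
  coordinate M y = coordinate M x -> coordinate N y = coordinate N x.
Proof.
by move=> MN; rewrite /coordinate -!(completionP _ MN) => ->.
Qed.

Definition directed_family :=
  F (nsubT L) /\ forall M N, F M -> F N -> F (nsubI M N).

Hypothesis F_dir : directed_family.

(** Since the family is directed, conditions on finitely many coordinates follow from a condition on
    a single one. *)
Lemma completion_nbhs (x : completion F) (U : set (completion F)) :
  nbhs x U ->
  exists N : F, forall y, coordinate N y = coordinate N x -> U y.
Proof.
(* The sets containing a cylinder around [x] form a filter, which converges to [x] in the product
   because it does so in each coordinate. *)
pose cyl : set_system (gquot_prod F) := fun A =>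
  exists N : F, forall y, coordinate N y = coordinate N x -> A (val y).
have cyl_filter : Filter cyl.
  split=> [|A B [M MA] [N NB]|A B AB [M MA]].
  - by exists (SigSub (mem_set F_dir.1)).
  - have FMN : F (nsubI (val M) (val N)) by apply: F_dir.2; exact: set_valP.
    exists (SigSub (mem_set FMN)) => y yx.
    split; [apply: MA|apply: NB]; apply: coordinate_sub yx => ? [] //.
  - by exists M => y /MA /AB.
have cv : cyl --> (val x : gquot_prod F).
  apply/cvg_sup => N A [_ [[B oB <-] Bx BA]]. 
  exists N => y /= yx; apply: BA => /=.
  by rewrite -[val y N]/(coordinate N y) yx.
rewrite nbhsE => -[_ [[B oB <-] Bx] BU].
have /cv[N NB] : nbhs (val x : gquot_prod F) B by exact: open_nbhs_nbhs.
by exists N => y /NB /BU.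
Qed.

End CompletionTheory.

Section ContinuousHoms.
Variables (G : topGroupType).

Definition discrete_hom (P : groupType) (h : G -> P) : Prop :=
  {morph h : x y / x * y} /\ continuous (h : G -> discrete_topology P).

Lemma mulgl_continuous (a : G) : continuous (fun x => a * x : G).
Proof.
move=> x; apply: (@continuous_comp _ _ _ (fun x => (a, x))
  (fun xy : G * G => xy.1 * xy.2)).
  by apply: cvg_pair; [exact: cvg_cst|exact: cvg_id].
exact: mulg_continuous.
Qed.

(** Every nonempty fibre is a translate of the open kernel. *)
Lemma open_kernel_discrete_hom (P : groupType) (h : G -> P) :
  {morph h : x y / x * y} -> open (h @^-1` [set 1]) -> discrete_hom h.
Proof.
move=> hM h1; split=> //; apply/continuous_discreteP => d.
rewrite openE => x /= hx; rewrite /interior.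
have : open ((fun y => x^-1 * y : G) @^-1` (h @^-1` [set 1])).
  by apply: open_comp => // y _; exact: mulgl_continuous.
move=> o; apply: filterS (open_nbhs_nbhs (conj o _)) => [y /=|]; last first.
  by rewrite /= mulVg (morph_one hM).
by rewrite hM (morph_inv hM) hx => /(congr1 (mulg d)); rewrite mulVKg mulg1.
Qed.

Lemma discrete_hom_open (P : groupType) (h : G -> P) :
  discrete_hom h -> open (h @^-1` [set 1]).
Proof. by move=> [_ /continuous_discreteP]; exact. Qed.

End ContinuousHoms.

Section CompletionHoms.
Variables (L : groupType) (F : set (nsubgroup L)).
Hypothesis F_dir : directed_family F.
Local Notation C := (completion F).

(** The image of [L] is dense: a cylinder around [x] over the index [N] contains the image of any
    representative of the coordinate of [x] at [N]. *)
Lemma discrete_hom_completion_ext (P : groupType) (h h' : C -> P) :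
  discrete_hom h -> discrete_hom h' ->
  (forall l, h (completion_of F l) = h' (completion_of F l)) -> h =1 h'.
Proof.
move=> [_ /continuous_discreteP hc] [_ /continuous_discreteP hc'] e x.
have : nbhs x (h @^-1` [set h x] `&` h' @^-1` [set h' x]).
  by apply: filterI; apply: open_nbhs_nbhs.
move=> /(completion_nbhs F_dir)[N Nx].
have [/= <- <-] := Nx (completion_of F (repr (coordinate N x))) (gquot_reprK _).
exact: e.
Qed.

Lemma discrete_hom_coordinate (N : F) : discrete_hom (@coordinate L F N).
Proof. by split; [exact: coordinateM|exact: coordinate_continuous]. Qed.

(** The kernel of [f] is one of the indices of the limit, so the lift is the coordinate at this
    index followed by the embedding of the quotient into [P]. *)
Lemma discrete_hom_lift (P : groupType) (f : L -> P)
    (fM : {morph f : x y / x * y}) :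
  F (kernel fM) ->
  exists2 h : C -> P, discrete_hom h & forall l, h (completion_of F l) = f l.
Proof.
move=> Ff; pose N : F := SigSub (mem_set Ff).
have Nf x : nsub (val N) x -> f x = 1 by [].
exists (fun x => gquot_lift f (coordinate N x)) => [|l].
  split=> [x y|]; first by rewrite coordinateM (gquot_liftM fM Nf).
  apply/continuous_discreteP => d.
  have /continuous_discreteP c := @coordinate_continuous L F N.
  rewrite openE => x /= xd.
  apply: filterS (open_nbhs_nbhs (conj (c (coordinate N x)) _)) => //.
  by move=> y /= ->.
exact: (gquot_lift_pi fM Nf).
Qed.

Lemma hom_to_completion (G : topGroupType) (h : forall N : F, G -> gquot (val N)) :
  (forall N, discrete_hom (h N)) ->
  (forall (M N : F) x, nsub (val M) `<=` nsub (val N) ->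
    gquot_map (val N) (h M x) = h N x) ->
  exists k : G -> C, [/\ {morph k : x y / x * y}, continuous k &
    forall N x, coordinate N (k x) = h N x].
Proof.
move=> hh hc; pose k x := @mk_completion L F (fun N => h N x)
  (fun M N MN => hc M N x MN).
exists k; split=> // [x y|].
  by apply: completion_eq => N; exact: (hh N).1.
by apply/continuous_completionP => N; exact: (hh N).2.
Qed.

End CompletionHoms.

(** * Universal properties *)

Lemma class_of_word_cat (T : choiceType) (R : set (seq (T * bool))) u v :
  class_of_word R (u ++ v) = class_of_word R u * class_of_word R v.
Proof. exact/esym/pres_mulE. Qed.

Lemma class_of_word_inv (T : choiceType) (R : set (seq (T * bool))) u :
  class_of_word R (inv_word u) = (class_of_word R u)^-1.
Proof. exact/esym/pres_invE. Qed.

Section PresentationLift.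
Variables (T : choiceType) (R : set (seq (T * bool))) (P : groupType).
Local Notation word := (seq (T * bool)).

Definition word_eval (f : T -> P) (w : word) : P :=
  foldr (fun p acc => (if p.2 then f p.1 else (f p.1)^-1) * acc) 1 w.

Lemma word_eval_cat f u v : word_eval f (u ++ v) = word_eval f u * word_eval f v.
Proof. by elim: u => [|p u IH] /=; rewrite ?mul1g // IH mulgA. Qed.

Lemma word_eval_cong f : (forall r, R r -> word_eval f r = 1) ->
  forall u v, word_cong R u v -> word_eval f u = word_eval f v.
Proof.
move=> fR u v; elim=> {u v} [//|u v _ -> //|u v w _ -> _ -> //||t b|r Rr].
- by move=> u u' v v' _ eu _ ev; rewrite !word_eval_cat eu ev.
- by case: b => /=; rewrite mulg1 ?mulgV ?mulVg.
- exact: fR.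
Qed.

Lemma presented_lift f : (forall r, R r -> word_eval f r = 1) ->
  exists2 h : presented R -> P, {morph h : x y / x * y} &
    forall t, h (generator R t) = f t.
Proof.
move=> fR; have ev u : word_eval f (repr (class_of_word R u)) = word_eval f u.
  by apply/word_eval_cong/class_of_wordP => //; exact: reprK.
exists (fun a => word_eval f (repr a)) => [|t]; last by rewrite ev /= mulg1.
elim/presented_ind => u; elim/presented_ind => v.
by rewrite -class_of_word_cat !ev word_eval_cat.
Qed.

Lemma presented_ext (h h' : presented R -> P) :
  {morph h : x y / x * y} -> {morph h' : x y / x * y} ->
  (forall t, h (generator R t) = h' (generator R t)) -> h =1 h'.
Proof.
move=> hM hM' e; elim/presented_ind; elim=> [|[t b] u IH].
  by rewrite (_ : class_of_word R [::] = 1) // !morph_one.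
rewrite -cat1s class_of_word_cat hM hM' IH; congr (_ * _).
case: b; first exact: e.
have -> : class_of_word R [:: (t, false)] = (generator R t)^-1.
  by rewrite /generator -class_of_word_inv.
by rewrite !morph_inv // e.
Qed.

End PresentationLift.

Definition converges_to_one (Y : Type) (G : topGroupType) (i : Y -> G) : Prop :=
  forall U : set G, nbhs (1 : G) U -> finite_set [set y | ~ U (i y)].

(** Only finite discrete 2-groups serve as targets. The groups to be compared are inverse limits of
    such groups, so this is enough to characterise them. *)
Definition free_on_set (G : topGroupType) (Y : Type) (i : Y -> G) : Prop :=
  [/\ converges_to_one i,
      forall (P : groupType) (f : Y -> P), two_group P ->
        finite_set [set y | f y <> 1] ->
        exists2 h : G -> P, discrete_hom h & h \o i =1 f
    & forall (P : groupType) (h h' : G -> P), two_group P ->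
        discrete_hom h -> discrete_hom h' -> h \o i =1 h' \o i -> h =1 h'].

Definition free_on_space (G : topGroupType) (X : topologicalType) (j : X -> G) :
    Prop :=
  [/\ continuous j, forall x, j x * j x = 1,
      forall (P : groupType) (g : X -> P), two_group P ->
        continuous (g : X -> discrete_topology P) ->
        (forall x, g x * g x = 1) ->
        exists2 h : G -> P, discrete_hom h & h \o j =1 g
    & forall (P : groupType) (h h' : G -> P), two_group P ->
        discrete_hom h -> discrete_hom h' -> h \o j =1 h' \o j -> h =1 h'].

Definition free_on (G : topGroupType) (Y : Type) (X : topologicalType)
    (i : Y -> G) (j : X -> G) : Prop :=
  [/\ converges_to_one i, continuous j, forall x, j x * j x = 1,
      forall (P : groupType) (f : Y -> P) (g : X -> P), two_group P ->
        finite_set [set y | f y <> 1] ->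
        continuous (g : X -> discrete_topology P) ->
        (forall x, g x * g x = 1) ->
        exists h : G -> P, [/\ discrete_hom h, h \o i =1 f & h \o j =1 g]
    & forall (P : groupType) (h h' : G -> P), two_group P ->
        discrete_hom h -> discrete_hom h' ->
        h \o i =1 h' \o i -> h \o j =1 h' \o j -> h =1 h'].

Lemma two_power_family_directed (L : groupType) (Q : nsubgroup L -> Prop) :
  Q (nsubT L) -> (forall M N, Q M -> Q N -> Q (nsubI M N)) ->
  directed_family [set N | two_power_index N /\ Q N].
Proof.
move=> QT QI; split; first by split=> //; exact: two_power_indexT.
by move=> M N [M2 QM] [N2 QN]; split; [exact: two_power_indexI|exact: QI].
Qed.

Section FreePro2.
Variable Y : choiceType.
Let Q (N : nsubgroup (free_group Y)) :=
  finite_set [set y : Y | ~ nsub N (generator set0 y)].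
Local Notation family :=
  [set N : nsubgroup (free_group Y) | two_power_index N /\ Q N].

Let family_directed : directed_family family.
Proof.
apply: two_power_family_directed => [|M N QM QN].
  rewrite /Q (_ : [set y : Y | ~ nsub (nsubT _) (generator set0 y)] = set0) //.
  by apply/seteqP; split=> // y /(_ I).
rewrite /Q; have : finite_set ([set y : Y | ~ nsub M (generator set0 y)] `|` 
   [set y : Y | ~ nsub N (generator set0 y)]) by rewrite finite_setU.
apply: sub_finite_set => y /=; apply: contra_notP.
by move=> /not_orP[/contrapT ? /contrapT ?].
Qed.

Definition free_pro2_gen (y : Y) : free_pro2 Y := completion_of _ (generator set0 y).

Lemma free_pro2P : free_on_set free_pro2_gen.
Proof.
split=> [U /(completion_nbhs family_directed)[N NU]|P f P2 f1|P h h' P2 hh hh' e].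
- have [_] := set_valP N; apply: sub_finite_set => y /=; apply: contra_not => Ny.
  by apply: NU; apply/esym/gquot_piP; rewrite invg1 mul1g.
- have [//|h hM hf] := @presented_lift Y set0 P f.
  have [|k kk kh] := @discrete_hom_lift _ family P h hM.
    split; first exact: two_power_index_kernel.
    by apply: sub_finite_set f1 => y /=; rewrite hf.
  by exists k => // y /=; rewrite kh hf.
apply: (discrete_hom_completion_ext family_directed) => //.
apply: (@presented_ext _ _ _ (h \o completion_of _) (h' \o completion_of _)).
- by move=> x y /=; rewrite completion_ofM hh.1.
- by move=> x y /=; rewrite completion_ofM hh'.1.
- exact: e.
Qed.

End FreePro2.

Section BooleanPro2.
Variable X : topologicalType.
Local Notation gen := (generator (@involution_relators X)).
Let Q (N : nsubgroup (involution_group X)) :=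
  continuous (fun x : X => gquot_pi N (gen x) : discrete_topology (gquot N)).
(** Continuity is expressed inside the group, without the quotient; in this form it is visibly
    stable under intersection of normal subgroups. *)
Let QP N : Q N <-> forall x, nbhs x [set y | nsub N ((gen x)^-1 * gen y)].
Proof.
rewrite /Q; split=> [/continuous_discreteP c x|c].
  have := open_nbhs_nbhs (conj (c (gquot_pi N (gen x))) erefl).
  by apply: filterS => y /= /esym /gquot_piP.
apply/continuous_discreteP => d; rewrite openE => x /= <-.
by apply: filterS (c x) => y /= Ny; apply/esym/gquot_piP.
Qed.
Local Notation family :=
  [set N : nsubgroup (involution_group X) | two_power_index N /\ Q N].

Let family_directed : directed_family family.
Proof.
apply: two_power_family_directed => [|M N /QP QM /QP QN]; apply/QP => x.
  exact: filterE.
by apply: filterI; [exact: QM|exact: QN].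
Qed.

Definition boolean_pro2_gen (x : X) : boolean_pro2 X := completion_of _ (gen x).

Lemma boolean_pro2P : free_on_space boolean_pro2_gen.
Proof.
split=> [|x|P g P2 gc g2|P h h' P2 hh hh' e].
- by apply/continuous_completionP => N; have [_] := set_valP N.
- rewrite -completion_ofM -class_of_word_cat.
  rewrite (_ : class_of_word _ _ = 1); last first.
    by apply/class_of_wordP/word_cong_relator; exists x.
  by apply: completion_eq.
- have [|h hM hf] := @presented_lift X (@involution_relators X) P g.
    by move=> _ [x _ <-] /=; rewrite mulg1 g2.
  have [|k kk kh] := @discrete_hom_lift _ family P h hM.
    split; first exact: two_power_index_kernel.
    apply/QP => x; move/continuous_discreteP: gc => gc.
    have := open_nbhs_nbhs (conj (gc (g x)) erefl).
    by apply: filterS => y /=; rewrite hM (morph_inv hM) !hf => ->; rewrite mulVg.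
  by exists k => // y /=; rewrite kh hf.
apply: (discrete_hom_completion_ext family_directed) => //.
apply: (@presented_ext _ _ _ (h \o completion_of _) (h' \o completion_of _)).
- by move=> x y /=; rewrite completion_ofM hh.1.
- by move=> x y /=; rewrite completion_ofM hh'.1.
- exact: e.
Qed.

End BooleanPro2.

Section FreePro2Product.
Variables G1 G2 : topGroupType.
Local Notation R := (@free_product_relators G1 G2).
Local Notation family :=
  [set N : nsubgroup (free_product G1 G2) |
    [/\ two_power_index N, open (@free_product_inl G1 G2 @^-1` nsub N) &
        open (@free_product_inr G1 G2 @^-1` nsub N)]].

Let family_directed : directed_family family.
Proof.
rewrite (_ : family = [set N | two_power_index N /\
    (open (@free_product_inl G1 G2 @^-1` nsub N) /\
     open (@free_product_inr G1 G2 @^-1` nsub N))]); last first.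
  by apply/seteqP; split=> N /= => [[? ? ?]|[? [? ?]]].
apply: two_power_family_directed => [|M N [? ?] [? ?]].
  by split; exact: openT.
by split; exact: openI.
Qed.

Lemma free_product_inlM : {morph @free_product_inl G1 G2 : a b / a * b}.
Proof.
move=> a b; have : class_of_word R
    [:: (inl a, true); (inl b, true); (inl (a * b), false)] = 1.
  by apply/class_of_wordP/word_cong_relator; left; exists a => //; exists b.
rewrite (class_of_word_cat R [:: (inl a, true)] [:: _; _]).
rewrite (class_of_word_cat R [:: (inl b, true)] [:: _]).
rewrite (class_of_word_inv R [:: (inl (a * b), true)]) mulgA.
by move=> /(congr1 (mulg^~ (free_product_inl G2 (a * b)))); rewrite mulgVK mul1g.
Qed.

Lemma free_product_inrM : {morph @free_product_inr G1 G2 : a b / a * b}.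
Proof.
move=> a b; have : class_of_word R
    [:: (inr a, true); (inr b, true); (inr (a * b), false)] = 1.
  by apply/class_of_wordP/word_cong_relator; right; exists a => //; exists b.
rewrite (class_of_word_cat R [:: (inr a, true)] [:: _; _]).
rewrite (class_of_word_cat R [:: (inr b, true)] [:: _]).
rewrite (class_of_word_inv R [:: (inr (a * b), true)]) mulgA.
by move=> /(congr1 (mulg^~ (free_product_inr G1 (a * b)))); rewrite mulgVK mul1g.
Qed.

Definition free_pro2_inl (a : G1) : free_pro2_product G1 G2 :=
  completion_of _ (free_product_inl G2 a).
Definition free_pro2_inr (a : G2) : free_pro2_product G1 G2 :=
  completion_of _ (free_product_inr G1 a).

Lemma free_pro2_inlM : {morph free_pro2_inl : a b / a * b}.
Proof. by move=> a b; rewrite -completion_ofM -free_product_inlM. Qed.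

Lemma free_pro2_inrM : {morph free_pro2_inr : a b / a * b}.
Proof. by move=> a b; rewrite -completion_ofM -free_product_inrM. Qed.

(** The openness conditions in the definition of the free product say that the factors map
    continuously to every quotient of the family. *)
Let pi_ker (G : topGroupType) (N : nsubgroup (free_product G1 G2))
    (f : G -> free_product G1 G2) : {morph f : a b / a * b} ->
  open (f @^-1` nsub N) -> discrete_hom (gquot_pi N \o f).
Proof.
move=> fM oN; apply: open_kernel_discrete_hom => [a b|].
  by rewrite /= fM gquot_piM.
rewrite (_ : _ @^-1` _ = f @^-1` nsub N) //; apply/seteqP; split=> a /=.
  by move=> /esym/gquot_piP; rewrite invg1 mul1g.
by move=> Na; apply/esym/gquot_piP; rewrite invg1 mul1g.
Qed.

Lemma free_pro2_inl_continuous : continuous free_pro2_inl.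
Proof.
apply/continuous_completionP => N; have [_ oN _] := set_valP N.
by have [_] := pi_ker free_product_inlM oN.
Qed.

Lemma free_pro2_inr_continuous : continuous free_pro2_inr.
Proof.
apply/continuous_completionP => N; have [_ _ oN] := set_valP N.
by have [_] := pi_ker free_product_inrM oN.
Qed.

Lemma free_pro2_product_lift (P : groupType) (f1 : G1 -> P) (f2 : G2 -> P) :
  two_group P -> discrete_hom f1 -> discrete_hom f2 ->
  exists h : free_pro2_product G1 G2 -> P,
    [/\ discrete_hom h, h \o free_pro2_inl =1 f1 & h \o free_pro2_inr =1 f2].
Proof.
move=> P2 f1h f2h.
have [|h hM hf] := @presented_lift _ R P
    (fun t => match t with inl a => f1 a | inr b => f2 b end).
  move=> r [] [a _ [b _ <-]] /=.
    by rewrite f1h.1 mulg1 mulgA mulgV.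
  by rewrite f2h.1 mulg1 mulgA mulgV.
have [|k kk kh] := @discrete_hom_lift _ family P h hM.
  split; first exact: two_power_index_kernel.
    rewrite (_ : _ @^-1` _ = f1 @^-1` [set 1]); first exact: discrete_hom_open.
    by apply/seteqP; split=> a /=; rewrite /free_product_inl hf.
  rewrite (_ : _ @^-1` _ = f2 @^-1` [set 1]); first exact: discrete_hom_open.
  by apply/seteqP; split=> a /=; rewrite /free_product_inr hf.
by exists k; split=> // a /=; rewrite kh hf.
Qed.

Lemma free_pro2_product_ext (P : groupType) (h h' : free_pro2_product G1 G2 -> P) :
  discrete_hom h -> discrete_hom h' ->
  h \o free_pro2_inl =1 h' \o free_pro2_inl ->
  h \o free_pro2_inr =1 h' \o free_pro2_inr -> h =1 h'.
Proof.
move=> hh hh' el er; apply: (discrete_hom_completion_ext family_directed) => //.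
apply: (@presented_ext _ _ _ (h \o completion_of _) (h' \o completion_of _)).
- by move=> x y /=; rewrite completion_ofM hh.1.
- by move=> x y /=; rewrite completion_ofM hh'.1.
- by case=> a; [exact: el|exact: er].
Qed.

End FreePro2Product.

Lemma converges_to_one_comp (Y : Type) (G H : topGroupType) (i : Y -> G)
    (k : G -> H) :
  {morph k : x y / x * y} -> continuous k -> converges_to_one i ->
  converges_to_one (k \o i).
Proof.
move=> kM kc ic U U1; apply: (ic (k @^-1` U)); apply: kc.
by rewrite (morph_one kM).
Qed.

Lemma discrete_hom_comp (G H : topGroupType) (k : G -> H) (P : groupType)
    (h : H -> P) :
  {morph k : x y / x * y} -> continuous k -> discrete_hom h ->
  discrete_hom (h \o k).
Proof.
move=> kM kc [hM hc]; split=> [x y|]; first by rewrite /= kM hM.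
by move=> x; apply: continuous_comp; [exact: kc|exact: hc].
Qed.

Lemma converges_to_one_discrete_hom (Y : Type) (G : topGroupType) (i : Y -> G)
    (P : groupType) (h : G -> P) :
  converges_to_one i -> discrete_hom h -> finite_set [set y | h (i y) <> 1].
Proof.
move=> ic hh; apply: (ic (h @^-1` [set 1])).
by apply: open_nbhs_nbhs; split; [exact: discrete_hom_open|exact: morph_one hh.1].
Qed.

Lemma discrete_hom_comp_continuous (G : topGroupType) (X : topologicalType)
    (j : X -> G) (P : groupType) (h : G -> P) :
  continuous j -> discrete_hom h ->
  continuous (h \o j : X -> discrete_topology P).
Proof. by move=> jc [_ hc] x; apply: continuous_comp; [exact: jc|exact: hc]. Qed.

Arguments free_pro2_inl {G1} G2 a.
Arguments free_pro2_inr G1 {G2} a.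

Section FreeOnProduct.
Variables (G1 G2 : topGroupType) (Y : Type) (X : topologicalType).
Variables (i : Y -> G1) (j : X -> G2).

Lemma free_on_product : free_on_set i -> free_on_space j ->
  free_on (free_pro2_inl G2 \o i) (free_pro2_inr G1 \o j).
Proof.
move=> [ic il iu] [jc j2 jl ju]; split.
- apply: converges_to_one_comp => //; first exact: free_pro2_inlM.
  exact: free_pro2_inl_continuous.
- move=> x; apply: continuous_comp; first exact: jc.
  exact: free_pro2_inr_continuous.
- by move=> x; rewrite /= -free_pro2_inrM j2 (morph_one (@free_pro2_inrM _ _)).
- move=> P f g P2 f1 gc g2.
  have [h1 hh1 e1] := il P f P2 f1.
  have [h2 hh2 e2] := jl P g P2 gc g2.
  have [h [hh hl hr]] := free_pro2_product_lift P2 hh1 hh2.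
  exists h; split=> // z; first by rewrite -e1; exact: hl.
  by rewrite -e2; exact: hr.
- move=> P h h' P2 hh hh' ei ej.
  have lh k : discrete_hom k -> discrete_hom (k \o free_pro2_inl G2 : G1 -> P).
    apply: discrete_hom_comp; first exact: free_pro2_inlM.
    exact: free_pro2_inl_continuous.
  have rh k : discrete_hom k -> discrete_hom (k \o free_pro2_inr G1 : G2 -> P).
    apply: discrete_hom_comp; first exact: free_pro2_inrM.
    exact: free_pro2_inr_continuous.
  apply: free_pro2_product_ext => //.
    by apply: (iu P) => //; exact: lh.
  by apply: (ju P) => //; exact: rh.
Qed.

End FreeOnProduct.

(** * Transport of the universal properties along isomorphisms *)

Lemma can_morphM (G H : groupType) (f : G -> H) (g : H -> G) :
  cancel f g -> cancel g f -> {morph f : x y / x * y} ->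
  {morph g : x y / x * y}.
Proof. by move=> fK gK fM x y; rewrite -{1}[x]gK -{1}[y]gK -fM fK. Qed.

Lemma top_isog_trans (G H K : topGroupType) :
  top_isog G H -> top_isog H K -> top_isog G K.
Proof.
move=> [f [g [fK gK fM fc gc]]] [f' [g' [fK' gK' fM' fc' gc']]].
exists (f' \o f), (g \o g'); split.
- exact: can_comp.
- exact: can_comp.
- by move=> x y; rewrite /= fM fM'.
- by move=> x; apply: continuous_comp; [exact: fc|exact: fc'].
- by move=> x; apply: continuous_comp; [exact: gc'|exact: gc].
Qed.

Section Transport.
Variables (G H : topGroupType) (f : G -> H) (g : H -> G).
Hypotheses (fK : cancel f g) (gK : cancel g f).
Hypothesis fM : {morph f : x y / x * y}.
Hypotheses (fc : continuous f) (gc : continuous g).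
Let gM := can_morphM fK gK fM.

Lemma free_on_set_transport (Y : Type) (i : Y -> H) :
  free_on_set i -> free_on_set (g \o i).
Proof.
move=> [ic il iu]; split.
- exact: converges_to_one_comp.
- move=> P u P2 u1; have [h hh e] := il P u P2 u1.
  exists (h \o f); first exact: discrete_hom_comp.
  by move=> y /=; rewrite gK -e.
- move=> P h h' P2 hh hh' e x; rewrite -[x]fK.
  by apply: (iu P (h \o g) (h' \o g)) => //; exact: discrete_hom_comp.
Qed.

Lemma free_on_space_transport (X : topologicalType) (j : X -> H) :
  free_on_space j -> free_on_space (g \o j).
Proof.
move=> [jc j2 jl ju]; split.
- by move=> x; apply: continuous_comp; [exact: jc|exact: gc].
- by move=> x; rewrite /= -gM j2 (morph_one gM).
- move=> P u P2 uc u2; have [h hh e] := jl P u P2 uc u2.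
  exists (h \o f); first exact: discrete_hom_comp.
  by move=> y /=; rewrite gK -e.
- move=> P h h' P2 hh hh' e x; rewrite -[x]fK.
  by apply: (ju P (h \o g) (h' \o g)) => //; exact: discrete_hom_comp.
Qed.

Lemma free_on_transport (Y : Type) (X : topologicalType) (i : Y -> H) (j : X -> H) :
  free_on i j -> free_on (g \o i) (g \o j).
Proof.
move=> [ic jc j2 ijl iju]; split.
- exact: converges_to_one_comp.
- by move=> x; apply: continuous_comp; [exact: jc|exact: gc].
- by move=> x; rewrite /= -gM j2 (morph_one gM).
- move=> P u v P2 u1 vc v2; have [h [hh hu hv]] := ijl P u v P2 u1 vc v2.
  exists (h \o f); split; first exact: discrete_hom_comp.
    by move=> y /=; rewrite gK -hu.
  by move=> y /=; rewrite gK -hv.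
- move=> P h h' P2 hh hh' e e' x; rewrite -[x]fK.
  by apply: (iju P (h \o g) (h' \o g)) => //; exact: discrete_hom_comp.
Qed.

End Transport.

Lemma free_on_set_isog (G H : topGroupType) (Y : Type) (i : Y -> H) :
  top_isog G H -> free_on_set i -> exists i' : Y -> G, free_on_set i'.
Proof.
move=> [f [g [fK gK fM fc gc]]].
by move=> /(free_on_set_transport fK gK fM fc gc); exists (g \o i).
Qed.

Lemma free_on_space_isog (G H : topGroupType) (X : topologicalType) (j : X -> H) :
  top_isog G H -> free_on_space j -> exists j' : X -> G, free_on_space j'.
Proof.
move=> [f [g [fK gK fM fc gc]]].
by move=> /(free_on_space_transport fK gK fM fc gc); exists (g \o j).
Qed.

Lemma free_on_isog (G H : topGroupType) (Y : Type) (X : topologicalType)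
    (i : Y -> H) (j : X -> H) : top_isog G H -> free_on i j ->
  exists (i' : Y -> G) (j' : X -> G), free_on i' j'.
Proof.
move=> [f [g [fK gK fM fc gc]]].
by move=> /(free_on_transport fK gK fM fc gc); exists (g \o i), (g \o j).
Qed.

(** * Uniqueness of the group with a given universal property *)

Section FreeOnCompletion.
Variables (Y : Type) (X : topologicalType).

(** Each coordinate of the map is supplied by the universal property, applied to the finite 2-group
    [gquot (val N)]. *)
Lemma free_on_completion_hom (G : topGroupType) (L : groupType)
    (F : set (nsubgroup L)) (i : Y -> G) (j : X -> G)
    (i' : Y -> completion F) (j' : X -> completion F) :
  F `<=` @two_power_index L -> free_on i j -> converges_to_one i' ->
  continuous j' -> (forall x, j' x * j' x = 1) ->
  exists k : G -> completion F,
    [/\ {morph k : x y / x * y}, continuous k, k \o i =1 i' & k \o j =1 j'].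
Proof.
move=> F2 [_ _ _ ijl iju] ic jc j2.
have N2 (N : F) : two_group (gquot (val N)) by exact/F2/set_valP.
have ex (N : F) : exists h : G -> gquot (val N),
    [/\ discrete_hom h, h \o i =1 @coordinate L F N \o i' &
        h \o j =1 @coordinate L F N \o j'].
  apply: ijl => //.
  - exact: N2.
  - exact: (converges_to_one_discrete_hom ic (discrete_hom_coordinate N)).
  - exact: (discrete_hom_comp_continuous jc (discrete_hom_coordinate N)).
  - by move=> x; rewrite /= -coordinateM j2.
pose h N := sval (cid (ex N)).
have hh N : discrete_hom (h N) by rewrite /h; case: cid => ? [].
have hi N : h N \o i =1 @coordinate L F N \o i' by rewrite /h; case: cid => ? [].
have hj N : h N \o j =1 @coordinate L F N \o j' by rewrite /h; case: cid => ? [].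
have [M N x MN|k [kM kc kh]] := @hom_to_completion L F G h hh.
  have mM : {morph gquot_map (M := val M) (val N) : a b / a * b}.
    elim/gquot_ind => a; elim/gquot_ind => b.
    by rewrite -gquot_piM !gquot_map_pi // gquot_piM.
  (* The coordinates are compatible because both homomorphisms into the quotient by [N] take the
     same values on the generators. *)
  move: x; apply: (iju _ (gquot_map (val N) \o h M) (h N)) => //.
  - exact: N2.
  - split=> [x y|]; first by rewrite /= (hh M).1 mM.
    have /continuous_discreteP hc := (hh M).2; apply/continuous_discreteP => d.
    rewrite openE => x /= xd.
    apply: filterS (open_nbhs_nbhs (conj (hc (h M x)) erefl)) => y /= ->.
    exact: xd.
  - by move=> y; rewrite /= [h M _]hi [h N _]hi; exact: completionP.
  - by move=> y; rewrite /= [h M _]hj [h N _]hj; exact: completionP.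
exists k; split=> // y; apply: completion_eq => N /=; rewrite kh; first exact: hi.
exact: hj.
Qed.

Lemma free_on_completion_ext (G : topGroupType) (L : groupType)
    (F : set (nsubgroup L)) (i : Y -> G) (j : X -> G) (k k' : G -> completion F) :
  F `<=` @two_power_index L -> free_on i j ->
  {morph k : x y / x * y} -> continuous k ->
  {morph k' : x y / x * y} -> continuous k' ->
  k \o i =1 k' \o i -> k \o j =1 k' \o j -> k =1 k'.
Proof.
move=> F2 [_ _ _ _ iju] kM kc kM' kc' ei ej x; apply: completion_eq => N.
have N2 : two_group (gquot (val N)) by exact/F2/set_valP.
apply: (iju _ (@coordinate L F N \o k) (@coordinate L F N \o k')).
- exact: N2.
- by apply: discrete_hom_comp => //; exact: discrete_hom_coordinate.
- by apply: discrete_hom_comp => //; exact: discrete_hom_coordinate.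
- by move=> y; congr (coordinate N _); exact: ei.
- by move=> y; congr (coordinate N _); exact: ej.
Qed.

(** The two maps given by the universal properties are mutually inverse because their composites fix
    the generators. Both groups are taken to be completions, since the universal property controls
    maps into inverse limits of finite 2-groups. *)
Lemma free_on_unique (L1 L2 : groupType) (F1 : set (nsubgroup L1))
    (F2 : set (nsubgroup L2)) (i1 : Y -> completion F1) (j1 : X -> completion F1)
    (i2 : Y -> completion F2) (j2 : X -> completion F2) :
  F1 `<=` @two_power_index L1 -> F2 `<=` @two_power_index L2 ->
  free_on i1 j1 -> free_on i2 j2 -> top_isog (completion F1) (completion F2).
Proof.
move=> FF1 FF2 h1 h2; have [ic1 jc1 s1 _ _] := h1; have [ic2 jc2 s2 _ _] := h2.
have [f [fM fc fi fj]] := free_on_completion_hom FF2 h1 ic2 jc2 s2.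
have [g [gM gc gi gj]] := free_on_completion_hom FF1 h2 ic1 jc1 s1.
have idc (T : topologicalType) : continuous (@id T) by move=> x; exact: cvg_id.
have compc (S T U : topologicalType) (u : S -> T) (v : T -> U) :
    continuous u -> continuous v -> continuous (v \o u).
  by move=> uc vc x; apply: continuous_comp; [exact: uc|exact: vc].
exists f, g; split=> //.
- apply: (free_on_completion_ext (k := g \o f) (k' := id) FF1 h1) => //.
  + by move=> x y /=; rewrite fM gM.
  + exact: compc.
  + exact: idc.
  + by move=> y; rewrite /= (fi y : f (i1 y) = _) (gi y : g (i2 y) = _).
  + by move=> y; rewrite /= (fj y : f (j1 y) = _) (gj y : g (j2 y) = _).
- apply: (free_on_completion_ext (k := f \o g) (k' := id) FF2 h2) => //.
  + by move=> x y /=; rewrite gM fM.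
  + exact: compc.
  + exact: idc.
  + by move=> y; rewrite /= (gi y : g (i2 y) = _) (fi y : f (i1 y) = _).
  + by move=> y; rewrite /= (gj y : g (j2 y) = _) (fj y : f (j1 y) = _).
Qed.

End FreeOnCompletion.

Local Close Scope group_scope.
Local Open Scope ring_scope.

(** * Bases of vector spaces *)

Section Exchange.
Variables (K : fieldType) (V : lmodType K).
Implicit Types (S T U : set V).

(** With this form, a property of the vectors in the span is proved by exhibiting the submodule of
    all vectors that have it. *)
Definition span S : set V :=
  [set v | forall W : submodule V, S `<=` subm W -> subm W v].

(** Independence without coefficients, suited to the exchange argument; [is_basis_lin_indep] links
    it to [is_basis]. *)
Definition lin_indep S : Prop := forall v, S v -> ~ span (S `\ v) v.

Lemma sub_span S : S `<=` span S.
Proof. by move=> v Sv W; exact. Qed.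

Lemma span_sub S T : S `<=` span T -> span S `<=` span T.
Proof. by move=> ST v Sv W TW; apply: Sv => w /ST; exact. Qed.

Lemma span_mono S T : S `<=` T -> span S `<=` span T.
Proof. by move=> ST; apply: span_sub => v /ST; exact: sub_span. Qed.

Lemma span0 S : span S 0.
Proof. by move=> W _; exact: subm0. Qed.

Lemma spanD S v w : span S v -> span S w -> span S (v + w).
Proof. by move=> Sv Sw W SW; apply: submD; [exact: Sv|exact: Sw]. Qed.

Lemma spanZ S a v : span S v -> span S (a *: v).
Proof. by move=> Sv W SW; apply/submZ/Sv. Qed.

Lemma span_sum S (I : Type) (r : seq I) (P : pred I) (F : I -> V) :
  (forall k, P k -> span S (F k)) -> span S (\sum_(k <- r | P k) F k).
Proof. by move=> h; elim/big_ind: _ => //; [exact: span0|exact: spanD]. Qed.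

(** The vectors in the span of some finite part of [S] form a submodule containing [S]. *)
Lemma span_finite S v : span S v ->
  exists2 s : seq V, [set` s] `<=` S & span [set` s] v.
Proof.
pose Q v := exists2 s : seq V, [set` s] `<=` S & span [set` s] v.
have Q0 : Q 0 by exists [::] => //; exact: span0.
have QD x y : Q x -> Q y -> Q (x + y).
  move=> [s sS sx] [t tS ty]; exists (s ++ t) => [z|].
    by rewrite /= mem_cat => /orP[/sS|/tS].
  apply: spanD; [apply: span_mono sx|apply: span_mono ty] => z /= zs.
    by rewrite mem_cat zs.
  by rewrite mem_cat zs orbT.
have QZ c x : Q x -> Q (c *: x).
  by move=> [s sS sx]; exists s => //; exact: spanZ.
move/(_ (Submodule Q0 QD QZ)); apply => x Sx /=.
exists [:: x] => [y|]; first by rewrite /= inE => /eqP ->.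
by apply: sub_span; rewrite /= inE.
Qed.

Lemma span_setU1 S y v : span (S `|` [set y]) v ->
  exists a, span S (v - a *: y).
Proof.
pose Q v := exists a, span S (v - a *: y).
have Q0 : Q 0 by exists 0; rewrite scale0r subr0; exact: span0.
have QD x z : Q x -> Q z -> Q (x + z).
  move=> [a xa] [b zb]; exists (a + b).
  by rewrite scalerDl opprD addrACA; exact: spanD.
have QZ c x : Q x -> Q (c *: x).
  move=> [a xa]; exists (c * a).
  by rewrite -scalerA -scalerBr; exact: spanZ.
move/(_ (Submodule Q0 QD QZ)); apply => x [Sx|->] /=.
  by exists 0; rewrite scale0r subr0; exact: sub_span.
by exists 1; rewrite scale1r subrr; exact: span0.
Qed.

Lemma lin_indep_sub S T : S `<=` T -> lin_indep T -> lin_indep S.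
Proof.
move=> ST Ti v Sv; apply: contra_not (Ti v (ST v Sv)).
by apply: span_mono => w [/ST].
Qed.

Lemma lin_indep_setU1 S y : lin_indep S -> ~ span S y -> lin_indep (S `|` [set y]).
Proof.
move=> Si yS v [Sv|->].
  have vy : v <> y by move=> vy; apply: yS; rewrite -vy; exact: sub_span.
  move=> vspan; have /span_setU1[a va] : span ((S `\ v) `|` [set y]) v.
    apply: span_mono vspan => w [[Sw|wy] wv]; last by right.
    by left.
  (* If [y] occurs with coefficient 0, then [v] depends on the rest of [S]; otherwise the relation
     can be solved for [y], which would lie in the span of [S]. *)
  have [a0|a0] := eqVneq a 0.
    by apply: (Si v Sv); rewrite a0 scale0r subr0 in va.
  apply: yS; rewrite -[y](scalerK a0); apply: spanZ.
  rewrite (_ : a *: y = v + -1 *: (v - a *: y)); last first.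
    by rewrite scaleN1r opprB addrC subrK.
  apply: spanD; first exact: sub_span.
  by apply: spanZ; apply: span_mono va => w [].
by apply: contra_not yS; apply: span_mono => w [[Sw|wy] wv].
Qed.

(* Zorn's lemma is applied to the partial injections R from S to T such that
   replacing the domain of R by its image keeps S linearly independent; R_disj
   says that an element of S in the image has itself been replaced, so that the
   replaced set does not merge elements. *)
Section Replacement.
Variables S T : set V.

Definition replaced (R : set (V * V)) : set V :=
  [set v | S v /\ (forall w, ~ R (v, w)) \/ exists u, R (u, v)].

Record replacement (R : set (V * V)) : Prop := Replacement {
  R_sub : forall v w, R (v, w) -> S v /\ T w;
  R_fun : forall v w w', R (v, w) -> R (v, w') -> w = w';
  R_inj : forall v v' w, R (v, w) -> R (v', w) -> v = v';
  R_indep : lin_indep (replaced R);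
  R_disj : forall v w, R (v, w) -> S w -> exists w', R (w, w')
}.

Lemma replacement_bigcup (F : set (set (V * V))) : lin_indep S ->
  F `<=` replacement -> total_on F subset ->
  replacement (\bigcup_(R in F) R).
Proof.
move=> Si FR Ftot.
have two p q : (\bigcup_(R in F) R) p -> (\bigcup_(R in F) R) q ->
    exists R, [/\ F R, R p & R q].
  move=> [R1 FR1 R1p] [R2 FR2 R2q].
  by have [/(_ _ R1p)|/(_ _ R2q)] := Ftot _ _ FR1 FR2; [exists R2|exists R1].
split.
- by move=> v w [R /FR h]; exact: R_sub h _ _.
- by move=> v w w' h h'; have [R [/FR r]] := two _ _ h h'; exact: R_fun.
- by move=> v v' w h h'; have [R [/FR r]] := two _ _ h h'; exact: R_inj.
(* For the empty chain the replaced set lies in [S]. For a nonempty chain, a dependence involves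
   finitely many vectors, and these all lie in the replaced set of one member. *)
- have [[R0 FR0]|F0] := pselect (exists R, F R); last first.
    apply: lin_indep_sub Si => v [[//]|[u [R FR1]]].
    by case: F0; exists R.
  (* A vector never replaced in the union is unreplaced in every member, and a vector in the image
     of the union is in the image from some member on. *)
  have stab c : replaced (\bigcup_(R in F) R) c -> exists2 R, F R &
      forall R', F R' -> R `<=` R' -> replaced R' c.
    move=> [[Sc nc]|[u [R FR1 Ruc]]].
      exists R0 => // R' FR' _; left; split=> // w Rw.
      by apply: (nc w); exists R'.
    by exists R => // R' _ RR'; right; exists u; exact: RR'.
  have stabs (s : seq V) : [set` s] `<=` replaced (\bigcup_(R in F) R) ->
      exists2 R, F R & [set` s] `<=` replaced R.
    move=> sU; suff [R FR1 h] : exists2 R, F R &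
        forall R', F R' -> R `<=` R' -> [set` s] `<=` replaced R'.
      by exists R => //; exact: h.
    elim: s sU => [|c s IH] sU; first by exists R0.
    have [|R1 FR1 h1] := IH; first by move=> z zs; apply: sU; rewrite /= inE zs orbT.
    have [R2 FR2 h2] := stab c (sU c (mem_head _ _)).
    have [R3 [FR3 R13 R23]] : exists R3, [/\ F R3, R1 `<=` R3 & R2 `<=` R3].
      have [h|h] := Ftot _ _ FR1 FR2; [exists R2|exists R1]; split=> // p.
    exists R3 => // R' FR' R3R' z; rewrite /= inE => /orP[/eqP ->|zs].
      by apply: h2 => //; apply: subset_trans R3R'.
    by apply: (h1 R' FR' (subset_trans R13 R3R')).
  move=> v Uv /span_finite[s sU sv].
  have [|R FR1 sR] := stabs (v :: s).
    by move=> z; rewrite /= inE => /orP[/eqP ->|/sU[]].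
  apply: (R_indep (FR _ FR1) (sR v (mem_head _ _))).
  apply: span_mono sv => z zs; split; last by have [_] := sU _ zs.
  by apply: sR; rewrite /= inE zs orbT.
- move=> v w [R FR1 Rvw] Sw; have [w' Rw] := R_disj (FR _ FR1) Rvw Sw.
  by exists w', R.
Qed.

(** Some [y] in [T] lies outside the span of the replaced set without [v]: otherwise this span would
    contain [T], hence [v], against independence. The new pair is [(v, y)]. *)
Lemma replacement_extend R v : (forall u, span T u) -> replacement R -> S v ->
  (forall w, ~ R (v, w)) -> exists2 w, ~ R (v, w) & replacement (R `|` [set (v, w)]).
Proof.
move=> Tspan [Rs Rf Ri Rl Rd] Sv nRv.
have Uv : replaced R v by left.
have [y Ty yU] : exists2 y, T y & ~ span (replaced R `\ v) y.
  apply: contrapT => h; apply: (Rl v Uv); apply: span_sub (Tspan v) => y Ty.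
  by apply: contrapT => ny; apply: h; exists y.
(* By [R_disj], a vector of [S] that is not yet replaced is outside the image of [R]. *)
have ran_v u : ~ R (u, v) by move=> /Rd -/(_ Sv)[w /nRv].
have nran u : ~ R (u, y).
  move=> Ruy; apply: yU; apply: sub_span; split; first by right; exists u.
  by move=> yv; apply: (ran_v u); rewrite -yv.
exists y => //; split.
- by move=> a b [/Rs//|[-> ->]].
- move=> a b b' [Rab|[av ->]] [Rab'|[av' ->]] //.
  + exact: Rf Rab Rab'.
  + by case: (nRv b); rewrite -av'.
  + by case: (nRv b'); rewrite -av.
- move=> a a' b [Rab|[-> bb]] [Rab'|[-> bb']] //.
  + exact: Ri Rab Rab'.
  + by case: (nran a); rewrite -bb'.
  + by case: (nran a'); rewrite -bb.
(* The new replaced set arises from the old one by exchanging [v] for [y]. *)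
- apply: (@lin_indep_sub _ ((replaced R `\ v) `|` [set y])); last first.
    apply: lin_indep_setU1 => //.
    by apply: lin_indep_sub Rl => z [].
  move=> c [[Sc nc]|[u [Ruc|[_ ->]]]]; last by right.
    left; split; first by left; split=> // w Rw; apply: (nc w); left.
    by move=> cv; apply: (nc y); right; rewrite cv.
  left; split; first by right; exists u.
  by move=> cv; apply: (ran_v u); rewrite -cv.
- move=> a b [Rab Sb|[_ ->] Sy].
    by have [w' Rw] := Rd _ _ Rab Sb; exists w'; left.
  have [->|yv] := eqVneq y v; first by exists v; right.
  have [[w Rw]|nRy] := pselect (exists w, R (y, w)); first by exists w; left.
  case: yU; apply: sub_span; split; last exact/eqP.
  by left; split=> // w Rw; apply: nRy; exists w.
Qed.

(** By [replacement_extend], a maximal replacement is defined on all of [S]; it is then the graph of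
    an injection into [T]. *)
Lemma lin_indep_card_le : lin_indep S -> (forall v, span T v) -> (S #<= T)%card.
Proof.
move=> Si Tspan.
have [R [Rr Rmax]] := Zorn_bigcup (fun F => @replacement_bigcup F Si).
have Rtot v : S v -> exists w, R (v, w).
  move=> Sv; apply: contrapT => nR.
  have nRv w : ~ R (v, w) by move=> Rw; apply: nR; exists w.
  have [w nw rw] := replacement_extend Tspan Rr Sv nRv.
  apply: (Rmax _ _ rw); split; first by move=> p; left.
  by move=> /(_ (v, w)) h; apply/nw/h; right.
have /choice[f fR] v : exists w, S v -> R (v, w).
  by have [/Rtot[w]|nS] := pselect (S v); [exists w|exists v].
have fi : {in S &, injective f}.
  move=> v w; rewrite !inE => Sv Sw e.
  by apply: (R_inj Rr (fR v Sv)); rewrite e; exact: fR.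
apply: card_le_trans (subset_card_le (_ : f @` S `<=` T)).
  by have := inj_card_eq fi; rewrite card_eq_le => /andP[].
by move=> _ [v Sv <-]; have [] := R_sub Rr (fR v Sv).
Qed.

End Replacement.
End Exchange.

Section Bases.
Variables (K : fieldType) (V : lmodType K).

Lemma sum_extend (s t : seq V) (c : V -> K) : uniq s -> uniq t ->
  {subset s <= t} ->
  \sum_(y <- t) (if y \in s then c y else 0) *: y = \sum_(y <- s) c y *: y.
Proof.
move=> us ut st; under eq_bigr do rewrite [_ *: _](fun_if (fun a => a *: _)) scale0r.
rewrite -big_mkcond -big_filter; apply: perm_big; apply: uniq_perm => //.
  exact: filter_uniq.
by move=> y; rewrite mem_filter; case: (boolP (y \in s)) => // /st ->.
Qed.

Lemma is_basis_lin_indep (Y : set V) : is_basis Y -> lin_indep Y.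
Proof.
move=> [Yf _] v Yv.
(* The vectors expressed through [Y] without [v] form a submodule. If [v] were among them, adding
   the coefficient -1 at [v] would give a nontrivial relation in [Y]. *)
pose Q w := exists s c,
  [/\ uniq s, [set` s] `<=` Y `\ v & w = \sum_(y <- s) c y *: y].
have Q0 : Q 0 by exists [::], (fun=> 0); rewrite big_nil.
have QD x y : Q x -> Q y -> Q (x + y).
  move=> [s [c [us sY ->]]] [t [d [ut tY ->]]].
  exists (undup (s ++ t)), (fun y =>
    (if y \in s then c y else 0) + (if y \in t then d y else 0)).
  split; first exact: undup_uniq.
    by move=> z /=; rewrite mem_undup mem_cat => /orP[/sY|/tY].
  under [RHS]eq_bigr do rewrite scalerDl.
  rewrite big_split /= !sum_extend ?undup_uniq // => z zs;
    by rewrite mem_undup mem_cat zs ?orbT.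
have QZ a x : Q x -> Q (a *: x).
  move=> [s [c [us sY ->]]]; exists s, (fun y => a * c y); split=> //.
  by rewrite scaler_sumr; apply: eq_bigr => y _; rewrite scalerA.
move/(_ (Submodule Q0 QD QZ)) => h.
have [w [Yw wv]|s [c [us sY vE]]] := h _.
  by exists [:: w], (fun=> 1); split=> [//|z /=|];
    rewrite ?inE ?big_seq1 ?scale1r // => /eqP ->.
have vs : v \notin s by apply/negP => /sY[_]; exact.
have : (if v == v then -1 else c v) = 0.
  apply: (Yf (v :: s) (fun y => if y == v then -1 else c y) _ _ _ v (mem_head _ _)).
  - by rewrite /= vs us.
  - by move=> z /=; rewrite inE => /orP[/eqP ->|/sY[]].
  rewrite big_cons eqxx scaleN1r {1}vE; apply/eqP; rewrite addrC subr_eq0; apply/eqP.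
  rewrite !big_seq; apply: eq_bigr => y ys.
  by rewrite (_ : y == v = false) //; apply/eqP => yv; rewrite -yv ys in vs.
by rewrite eqxx => /eqP; rewrite oppr_eq0 oner_eq0.
Qed.

Lemma is_basis_span (Y : set V) v : is_basis Y -> span Y v.
Proof.
move=> [_ /(_ v)[s [c [sY ->]]]]; rewrite big_seq; apply: span_sum => y ys.
by apply/spanZ/sub_span/sY.
Qed.

End Bases.

(** The exchange inequality holds in both directions, and Cantor-Bernstein gives the bijection. *)
Lemma basis_bijection (K : fieldType) (V : lmodType K) (I : Type) (e : I -> V)
    (Y : set V) :
  injective e -> lin_indep (range e) -> (forall v, span (range e) v) ->
  is_basis Y -> exists t : I -> Y, bijective t.
Proof.
move=> ei el es Yb.
have /card_bijP[f [g fK gK]] : (range e #= Y)%card.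
  apply/card_eqPle; split; apply: lin_indep_card_le => //.
    by move=> v; exact: is_basis_span.
  exact: is_basis_lin_indep.
have ein x : e x \in range e by rewrite inE; exists x.
have /choice[h hP] (v : range e) : exists x, e x = val v.
  by have [x _ <-] := set_valP v; exists x.
exists (fun x => f (SigSub (ein x))), (h \o g) => [x|y] /=.
  by apply: ei; rewrite hP fK.
by rewrite -[RHS]gK; congr f; apply: val_inj; rewrite /= hP.
Qed.

(** * Cohomology in degrees 1 and 2 *)

Section DegreeOne.
Variable G : topGroupType.
Local Notation H1 := (cohomology G 1).
Local Notation H2 := (cohomology G (1 + 1)).

Definition pow1 (g : G) : gpow G 1 := fun=> g.
Definition pow2 (g h : G) : gpow G 2 := fun i => if i == ord0 then g else h.

Lemma gpow1E (s : gpow G 1) : s = pow1 (s ord0).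
Proof. by apply/funext => k; rewrite /pow1; congr s; exact: ord1. Qed.

Lemma gpow2E (s : gpow G 2) : s = pow2 (s ord0) (s (lift ord0 ord0)).
Proof.
apply/funext => k; rewrite /pow2; case: eqP => [->//|].
by case: (unliftP ord0 k) => [k' ->|->//] _; congr s; rewrite ord1.
Qed.

Lemma F2_addxx (x : 'F_2) : x + x = 0.
Proof. by case: x => [[|[|]]] // ?; exact/val_inj. Qed.

Lemma F2_mulxx (x : 'F_2) : x * x = x.
Proof. by case: x => [[|[|]]] // ?; exact/val_inj. Qed.

(** Both faces of a 1-tuple are the empty tuple, and their contributions cancel in ['F_2]. *)
Lemma differential0E (f : cochain G 0) : differential f = 0.
Proof.
apply/funext => s; rewrite /differential !big_ord_recl big_ord0 addr0.
have e k : face k s = face 0 s by apply/funext; case.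
by rewrite !(e _) F2_addxx.
Qed.

Lemma differential1E (f : cochain G 1) g h :
  differential f (pow2 g h) = f (pow1 g) + f (pow1 h) + f (pow1 (g * h)%g).
Proof.
rewrite /differential !big_ord_recl big_ord0 addr0.
rewrite (_ : face _ _ = pow1 h); last by apply/funext => k; rewrite /face [k]ord1.
rewrite (_ : face _ _ = pow1 (g * h)%g); last by apply/funext => k; rewrite /face [k]ord1.
rewrite (_ : face _ _ = pow1 g); last by apply/funext => k; rewrite /face [k]ord1.
by rewrite addrC -addrA addrC -addrA; congr (_ + _); rewrite addrC.
Qed.

Lemma pow1_continuous : continuous pow1.
Proof. by apply/continuous_prodP => k x; exact: cvg_id. Qed.

Lemma coord_gpow_continuous n (k : 'I_n) : continuous (fun s : gpow G n => s k).
Proof. by move: k; apply/continuous_prodP => x; exact: cvg_id. Qed.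

(** The only coboundary in degree 1 is zero, so a class consists of a single cocycle, which is a
    continuous homomorphism from [G] to ['F_2]. *)
Definition res (a : H1) (g : G) : 'F_2 := (val (repr a) : cochain G 1) (pow1 g).

Lemma res_class (z : cocycle G 1) g :
  res (cohomology_class z) g = (val z : cochain G 1) (pow1 g).
Proof.
have /mquot_piP/= [c _] : cohomology_class (repr (cohomology_class z)) =
    cohomology_class z.
  exact: mquot_reprK.
rewrite differential0E => e; apply/eqP; rewrite -subr_eq0; apply/eqP.
by rewrite /res -[LHS]/((val (repr (cohomology_class z)) - val z : cochain G 1) _) -e.
Qed.

Lemma resD a b g : res (a + b) g = res a g + res b g.
Proof.
elim/cohomology_ind: a => x; elim/cohomology_ind: b => y.
by rewrite -cohomology_classD !res_class.
Qed.

Lemma res_inj a b : res a =1 res b -> a = b.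
Proof.
elim/cohomology_ind: a => x; elim/cohomology_ind: b => y e.
congr cohomology_class; apply: val_inj; apply/funext => s.
by rewrite [s]gpow1E; have := e (s ord0); rewrite !res_class.
Qed.

Lemma resM a : {morph res a : g h / (g * h)%g >-> g + h}.
Proof.
elim/cohomology_ind: a => x g h; rewrite !res_class.
have [_ /(congr1 (fun f : cochain G 2 => f (pow2 g h)))] := cocycleP x.
rewrite differential1E => /eqP; rewrite -[X in _ == X]/(0 : 'F_2).
by rewrite addr_eq0 => /eqP ->; apply/eqP; rewrite -addr_eq0 F2_addxx.
Qed.

Lemma res_continuous a : continuous (res a : G -> discrete_topology 'F_2).
Proof.
elim/cohomology_ind: a => x; rewrite (_ : res _ = (val x : cochain G 1) \o pow1).
  have [xc _] := cocycleP x => g.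
  by apply: continuous_comp; [exact: pow1_continuous|exact: xc].
by apply/funext => g; rewrite res_class.
Qed.

Lemma res_surj (u : G -> 'F_2) : {morph u : g h / (g * h)%g >-> g + h} ->
  continuous (u : G -> discrete_topology 'F_2) -> exists a, res a =1 u.
Proof.
move=> uM uc; pose f : cochain G 1 := fun s => u (s ord0).
have fz : f \in @is_cocycle G 1.
  apply/asboolP; split.
    move=> s; apply: (@continuous_comp _ _ _ (fun s : gpow G 1 => s ord0)).
      exact: coord_gpow_continuous.
    exact: uc.
  apply/funext => s; rewrite [s]gpow2E differential1E /f /pow1 uM F2_addxx.
  by [].
by exists (cohomology_class (Cocycle fz)) => g; rewrite res_class.
Qed.

Lemma cup_pow2 (f f' : cochain G 1) g h :
  cup_cochain f f' (pow2 g h) = f (pow1 g) * f' (pow1 h).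
Proof.
rewrite /cup_cochain; congr (f _ * f' _); apply/funext => k; rewrite [k]ord1.
by [].
Qed.

(** Here [s] is a 1-cochain whose coboundary is the difference of the two product cocycles. *)
Lemma cup_eqP (a b c d : H1) : cup a b = cup c d <->
  exists2 s : G -> 'F_2, continuous (s : G -> discrete_topology 'F_2) &
    forall g h, res a g * res b h - res c g * res d h = s g + s h + s (g * h)%g.
Proof.
elim/cohomology_ind: a => a; elim/cohomology_ind: b => b.
elim/cohomology_ind: c => c; elim/cohomology_ind: d => d.
rewrite !cupE; split=> [/mquot_piP/=[f fc e]|[s sc e]].
  exists (f \o pow1) => [g|g h].
    by apply: continuous_comp; [exact: pow1_continuous|exact: fc].
  by rewrite /= -differential1E e !res_class -!cup_pow2.
apply/mquot_piP => /=; exists (fun t => s (t ord0)).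
  move=> t; apply: (@continuous_comp _ _ _ (fun t : gpow G 1 => t ord0)).
    exact: coord_gpow_continuous.
  exact: sc.
apply/funext => t; rewrite [t]gpow2E differential1E /= -e !res_class -!cup_pow2.
by [].
Qed.

End DegreeOne.

(* F_2^3 extended by F_2 along the 2-cocycle x1 y2 + x3 y3. *)
Definition cup_ext : Type := ('F_2 * 'F_2 * 'F_2 * 'F_2)%type.
HB.instance Definition _ := Choice.on cup_ext.

Definition cup_ext_mul (x y : cup_ext) : cup_ext :=
  let: (a, b, c, s) := x in let: (a', b', c', s') := y in
  (a + a', b + b', c + c', s + s' + (a * b' + c * c')).
Definition cup_ext_inv (x : cup_ext) : cup_ext :=
  let: (a, b, c, s) := x in (- a, - b, - c, - s + (a * b + c * c)).
Definition cup_ext_one : cup_ext := (0, 0, 0, 0).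

Lemma cup_ext_mulA : associative cup_ext_mul.
Proof.
move=> [[[a b] c] s] [[[a' b'] c'] s'] [[[a2 b2] c2] s2] /=.
by congr (_, _, _, _); ring.
Qed.
Lemma cup_ext_mul1 : left_id cup_ext_one cup_ext_mul.
Proof. by move=> [[[a b] c] s] /=; congr (_, _, _, _); ring. Qed.
Lemma cup_ext_mulr1 : right_id cup_ext_one cup_ext_mul.
Proof. by move=> [[[a b] c] s] /=; congr (_, _, _, _); ring. Qed.
Lemma cup_ext_mulV : left_inverse cup_ext_one cup_ext_inv cup_ext_mul.
Proof. by move=> [[[a b] c] s] /=; congr (_, _, _, _); ring. Qed.
Lemma cup_ext_mulrV : right_inverse cup_ext_one cup_ext_inv cup_ext_mul.
Proof. by move=> [[[a b] c] s] /=; congr (_, _, _, _); ring. Qed.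

HB.instance Definition _ := isGroup.Build cup_ext
  cup_ext_mulA cup_ext_mul1 cup_ext_mulr1 cup_ext_mulV cup_ext_mulrV.

Lemma two_group_finite (P : groupType) (T : finType) (f : P -> T) (g : T -> P) k :
  cancel f g -> cancel g f -> #|T| = (2 ^ k)%N -> two_group P.
Proof.
move=> fK gK Tk; exists k; rewrite -Tk.
apply: (@ordinal_card _ _ (enum_rank \o f) (g \o enum_val)).
  by apply: can_comp => //; exact: enum_rankK.
by apply: can_comp => //; exact: enum_valK.
Qed.

Lemma two_group_cup_ext : two_group cup_ext.
Proof.
apply: (@two_group_finite cup_ext ('F_2 * 'F_2 * 'F_2 * 'F_2)%type id id 4) => //.
by rewrite !card_prod !card_ord.
Qed.

Lemma two_group_F2 : two_group 'F_2.
Proof. by apply: (@two_group_finite _ 'F_2 id id 1) => //; rewrite card_ord. Qed.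

Lemma F2_oneE : (1%g : 'F_2) = 0. Proof. by []. Qed.

Lemma F2_oppr (x : 'F_2) : - x = x.
Proof. by apply/eqP; rewrite eq_sym -addr_eq0 F2_addxx. Qed.

(** A square in the extension has last component [a * b + c * c], which vanishes for [c = a * b]. *)
Lemma cup_ext_involution (a b : 'F_2) :
  let x : cup_ext := (a, b, a * b, 0) in (x * x)%g = 1%g.
Proof.
by move=> x; rewrite -[LHS]/(cup_ext_mul _ _) /= F2_mulxx !F2_addxx.
Qed.

Lemma discrete_hom_post (G : topGroupType) (P Q : groupType)
    (h : G -> P) (p : P -> Q) :
  {morph p : x y / (x * y)%g} -> discrete_hom h -> discrete_hom (p \o h).
Proof.
move=> pM [hM /continuous_discreteP hc]; split=> [x y|]; first by rewrite /= hM pM.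
apply/continuous_discreteP => d; rewrite openE => x /= xd.
by apply: filterS (open_nbhs_nbhs (conj (hc (h x)) erefl)) => y /= ->.
Qed.

(** * Products of degree 1 classes under the universal property *)

Section FreeCohomology.
Variables (G : topGroupType) (Y : Type) (X : topologicalType).
Variables (i : Y -> G) (j : X -> G).
Hypothesis ij : free_on i j.
Local Notation H1 := (cohomology G 1).

Lemma discrete_hom_res (a : H1) : discrete_hom (res a : G -> 'F_2).
Proof. by split; [exact: resM|exact: res_continuous]. Qed.

Lemma res_ext (a b : H1) :
  res a \o i =1 res b \o i -> res a \o j =1 res b \o j -> a = b.
Proof.
move=> ei ej; apply: res_inj; have [_ _ _ _ iju] := ij.
apply: (iju 'F_2 _ _ two_group_F2) => //; exact: discrete_hom_res.
Qed.

Lemma res_exists (f : Y -> 'F_2) (g : X -> 'F_2) :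
  finite_set [set y | f y <> 0] -> continuous (g : X -> discrete_topology 'F_2) ->
  exists2 a : H1, res a \o i =1 f & res a \o j =1 g.
Proof.
move=> ff gc; have [_ _ _ ijl _] := ij.
have [|h [hh hf hg]] := ijl 'F_2 f g two_group_F2 ff gc.
  by move=> x; exact: F2_addxx.
have [a ha] := res_surj hh.1 hh.2.
exists a => z; [rewrite -hf|rewrite -hg]; exact: ha.
Qed.

(** A homomorphism from [G] to [cup_ext] with first components [res a], [res b], [res c] has as last
    component a cochain bounding the difference of the products. The hypothesis on [c] makes the
    prescribed images of the [j x] square to 1, so that the homomorphism exists. *)
Lemma cup_square_eq (a b c : H1) :
  (forall x, res c (j x) = res a (j x) * res b (j x)) -> cup a b = cup c c.
Proof.
move=> cab; have [ic jc j2 ijl iju] := ij.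
(* In general [v] is not a homomorphism; only its values on the generators are prescribed for
   [h]. *)
pose v g : cup_ext := (res a g, res b g, res c g, 0).
have vopen g : nbhs g [set g' | v g' = v g].
  have o (e : H1) : nbhs g [set g' | res e g' = res e g].
    have [_ /continuous_discreteP ec] := discrete_hom_res e.
    exact: (open_nbhs_nbhs (conj (ec (res e g)) erefl)).
  apply: (filterS _ (filterI (filterI (o a) (o b)) (o c))).
  by move=> g' [[/= ea eb] ec]; rewrite /v ea eb ec.
have [h [[hM hc] hi hj]] : exists h : G -> cup_ext,
    [/\ discrete_hom h, h \o i =1 v \o i & h \o j =1 v \o j].
  apply: ijl; first exact: two_group_cup_ext.
  - have v1 : v 1%g = 1%g by rewrite /v !(morph_one (resM _)).
    by have := ic _ (vopen 1%g); apply: sub_finite_set => y; rewrite v1.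
  - apply/continuous_discreteP => d; rewrite openE => x /= <-.
    exact: (jc x _ (vopen (j x))).
  - by move=> x; rewrite /= /v cab cup_ext_involution.
(* The first three components of [h] agree with the given classes on the generators, hence
   everywhere by uniqueness. *)
have post (p : cup_ext -> 'F_2) (e : H1) :
    {morph p : x y / (x * y)%g >-> (x * y)%g} -> p \o v =1 res e -> p \o h =1 res e.
  move=> pM pv; apply: (iju 'F_2 _ _ two_group_F2) => [||y|x].
  - exact: discrete_hom_post.
  - exact: discrete_hom_res.
  - by rewrite -[RHS]pv; congr p; exact: hi.
  - by rewrite -[RHS]pv; congr p; exact: hj.
have ha : (fun x : cup_ext => x.1.1.1) \o h =1 res a.
  by apply: post => // -[[[? ?] ?] ?] [[[? ?] ?] ?].
have hb : (fun x : cup_ext => x.1.1.2) \o h =1 res b.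
  by apply: post => // -[[[? ?] ?] ?] [[[? ?] ?] ?].
have hcc : (fun x : cup_ext => x.1.2) \o h =1 res c.
  by apply: post => // -[[[? ?] ?] ?] [[[? ?] ?] ?].
apply/cup_eqP; exists (fun g => (h g).2).
  move/continuous_discreteP: hc => hc.
  apply/continuous_discreteP => d; rewrite openE => x /= xd.
  by apply: filterS (open_nbhs_nbhs (conj (hc (h x)) erefl)) => y /= ->.
move=> g g'; rewrite -ha -hb -!hcc /= hM.
case: (h g) (h g') => [[[a1 b1] c1] s1] [[[a2 b2] c2] s2].
rewrite -[(_ * _)%g]/(cup_ext_mul _ _) /= F2_oppr addrA F2_addxx.
by rewrite add0r.
Qed.

(** If [s] bounds the square, evaluation at the pair [(j x, j x)] gives [res a (j x) = s 1], because
    [j x] is an involution, and evaluation at [(1, 1)] gives [s 1 = 0]. *)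
Lemma cup_square0 (a : H1) : cup a a = 0 -> forall x, res a (j x) = 0.
Proof.
move=> a0 x; have [_ _ j2 _ _] := ij.
have /cup_eqP[s _ e] : cup a a = cup (0 : H1) (0 : H1).
  by rewrite a0 -[X in cup X _](scale0r 0) cupZl scale0r.
have r0 g : res (0 : H1) g = 0.
  by apply: (addrI (res 0 g)); rewrite -resD !addr0.
have s1 : s 1%g = 0.
  have := e 1%g 1%g; rewrite !(morph_one (resM a)) !r0 mulg1 F2_addxx add0r => <-.
  by rewrite F2_oneE !mul0r subr0.
by have := e (j x) (j x); rewrite F2_mulxx !r0 mul0r subr0 F2_addxx add0r j2 s1.
Qed.

End FreeCohomology.

Lemma F2_neq0 (x : 'F_2) : x <> 0 -> x = 1.
Proof.
case: x => [[|[|//]]] x2 x0; last exact: val_inj.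
by case: x0; exact: val_inj.
Qed.

(** * Recovery of the Boolean ring and of the dual part from the cohomology *)

Section QuasiBooleanCohomology.
Variables (G : topGroupType) (Y : choiceType) (X : topologicalType).
Variables (i : Y -> G) (j : X -> G).
Hypothesis ij : free_on i j.
Variables (D : lmodType 'F_2) (B : booleanRingType).
Local Notation H1 := (cohomology G 1).
Variables (phi : H1 -> D * B) (phi' : D * B -> H1).
Hypotheses (phiK : cancel phi phi') (phiK' : cancel phi' phi).
Hypothesis phi'D : {morph phi' : p q / p + q}.
Hypothesis cup_phi : forall a b c d : H1,
  cup a b = cup c d <-> (phi a).2 * (phi b).2 = (phi c).2 * (phi d).2.

(** The next two maps identify [B] with the continuous functions from [X] to ['F_2], and [D] with
    the finitely supported functions on [Y]. *)
Definition boolean_part (b : B) (x : X) : 'F_2 := res (phi' (0, b)) (j x).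
Definition dual_part (d : D) (y : Y) : 'F_2 := res (phi' (d, 0)) (i y).

Lemma res0 g : res (0 : H1) g = 0.
Proof. by apply: (addrI (res 0 g)); rewrite -resD !addr0. Qed.

Lemma phi'0 : phi' 0 = 0.
Proof. by apply: (addrI (phi' 0)); rewrite -phi'D !addr0. Qed.

Lemma phi0 : phi 0 = 0.
Proof. by rewrite -phi'0 phiK'. Qed.

(** Both sides are equivalent to the vanishing of [cup a a]; on the right this uses that every
    element of [B] is idempotent. *)
Lemma res_j_eq0 a : (forall x, res a (j x) = 0) <-> (phi a).2 = 0.
Proof.
split=> [a0|a0].
  have /cup_phi : cup a a = cup (0 : H1) 0.
    by apply: (cup_square_eq ij) => x; rewrite a0 res0 mul0r.
  by rewrite phi0 mulbb mulr0.
apply: (cup_square0 ij).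
have /cup_phi -> : (phi a).2 * (phi a).2 = (phi 0).2 * (phi 0).2.
  by rewrite a0 phi0.
by rewrite -[X in cup X _](scale0r 0) cupZl scale0r.
Qed.

Lemma phi_split a : a = phi' ((phi a).1, 0) + phi' (0, (phi a).2).
Proof.
rewrite -phi'D [_ + _]surjective_pairing /= addr0 add0r.
by rewrite -surjective_pairing phiK.
Qed.

Lemma res_jE a x : res a (j x) = boolean_part (phi a).2 x.
Proof.
have d0 z : res (phi' ((phi a).1, 0)) (j z) = 0.
  by move: z; apply/res_j_eq0; rewrite phiK'.
by rewrite {1}[a]phi_split resD d0 add0r.
Qed.

Lemma boolean_partD b c x :
  boolean_part (b + c) x = boolean_part b x + boolean_part c x.
Proof.
rewrite /boolean_part -resD -phi'D; congr (res (phi' _) _).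
by rewrite [RHS]surjective_pairing /= addr0.
Qed.

Lemma boolean_part_inj b : (forall x, boolean_part b x = 0) -> b = 0.
Proof. by move=> /res_j_eq0; rewrite phiK'. Qed.

Lemma boolean_part_continuous b :
  continuous (boolean_part b : X -> discrete_topology 'F_2).
Proof.
have [_ jc _ _ _] := ij.
exact: (discrete_hom_comp_continuous jc (discrete_hom_res (phi' (0, b)))).
Qed.

Lemma boolean_part_surj (g : X -> 'F_2) :
  continuous (g : X -> discrete_topology 'F_2) -> exists b, boolean_part b =1 g.
Proof.
have f0 : finite_set [set y : Y | (fun=> 0 : 'F_2) y <> 0].
  by rewrite (_ : [set y | _] = set0) //; apply/seteqP; split.
move=> /(res_exists ij f0)[a _ ag]; exists (phi a).2 => x.
by rewrite -res_jE -ag.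
Qed.

Lemma boolean_partM b c x :
  boolean_part (b * c) x = boolean_part b x * boolean_part c x.
Proof.
have f0 : finite_set [set y : Y | (fun=> 0 : 'F_2) y <> 0].
  by rewrite (_ : [set y | _] = set0) //; apply/seteqP; split.
have gc : continuous ((fun x => boolean_part b x * boolean_part c x) :
    X -> discrete_topology 'F_2).
  by apply: (@continuous_discrete_op _ _ _ _ (fun u v : 'F_2 => u * v));
    exact: boolean_part_continuous.
(* A class [a] restricting to the product function satisfies [cup a a = cup b c] for the classes of
   [b] and [c], so its [B]-component, being idempotent, is [b * c]. *)
have [a _ ag] := res_exists ij f0 gc.
have /cup_phi : cup (phi' (0, b)) (phi' (0, c)) = cup a a.
  by apply: (cup_square_eq ij) => z; exact: ag.
by rewrite !phiK' mulbb /= => bc; rewrite bc -res_jE; exact: ag.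
Qed.

Lemma dual_partD d e y : dual_part (d + e) y = dual_part d y + dual_part e y.
Proof.
rewrite /dual_part -resD -phi'D; congr (res (phi' _) _).
by rewrite [RHS]surjective_pairing /= addr0.
Qed.

Lemma dual_part0 y : dual_part 0 y = 0.
Proof. by rewrite /dual_part phi'0 res0. Qed.

Lemma dual_part_inj d : (forall y, dual_part d y = 0) -> d = 0.
Proof.
move=> d0; suff e : phi' (d, 0) = 0 by have := phiK' (d, 0); rewrite e phi0 => -[].
apply: (res_ext ij) => [y|x] /=; rewrite res0; first exact: d0.
by move: x; apply/res_j_eq0; rewrite phiK'.
Qed.

Lemma dual_part_finite d : finite_set [set y | dual_part d y <> 0].
Proof.
have [ic _ _ _ _] := ij.
exact: (converges_to_one_discrete_hom ic (discrete_hom_res (phi' (d, 0)))).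
Qed.

Lemma dual_part_surj (f : Y -> 'F_2) : finite_set [set y | f y <> 0] ->
  exists d, dual_part d =1 f.
Proof.
move=> ff; have [a af a0] := res_exists ij ff
  (@cst_continuous X (discrete_topology 'F_2) 0).
exists (phi a).1 => y; rewrite -af /= {2}[a]phi_split resD.
rewrite (_ : (phi a).2 = 0); last by apply/res_j_eq0 => x; exact: a0.
by rewrite phi'0 res0 addr0.
Qed.

(** The basis corresponds to the indicator functions of the points of [Y]. Evaluation at [y]
    separates [e y] from the span of the others, and each [d] is the sum of the [e y] over its
    support. *)
Lemma dual_basis : exists e : Y -> D,
  [/\ injective e, lin_indep (range e) & forall d, span (range e) d].
Proof.
have /choice[e eP] y : exists d, dual_part d =1 fun z => (z == y)%:R.
  apply: dual_part_surj; apply: (@sub_finite_set _ _ [set y]);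
    last exact: finite_set1.
  by move=> z /=; case: eqP.
have dual_partZ a d y : dual_part d y = 0 -> dual_part (a *: d) y = 0.
  case: a => [[|[|//]]] a2 d0.
    by rewrite (_ : Ordinal a2 = 0) ?scale0r ?dual_part0 //; exact: val_inj.
  by rewrite (_ : Ordinal a2 = 1) ?scale1r //; exact: val_inj.
exists e; split.
- move=> y z yz; have := eP y y; rewrite yz eP eqxx.
  by case: eqP => // _ /eqP; rewrite eq_sym oner_eq0.
- move=> _ [y _ <-].
  have W0 : dual_part 0 y = 0 := dual_part0 y.
  have WD d d' : dual_part d y = 0 -> dual_part d' y = 0 -> dual_part (d + d') y = 0.
    by move=> d0 d0'; rewrite dual_partD d0 d0' addr0.
  move/(_ (@Submodule _ D [set d | dual_part d y = 0] W0 WD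
    (fun a d => @dual_partZ a d y))).
  have h : range e `\ e y `<=` [set d | dual_part d y = 0].
    move=> _ [[z _ <-] zy] /=; rewrite eP; case: eqP => // yz.
    by case: zy; rewrite yz.
  by move=> /(_ h) /=; rewrite eP eqxx => /eqP; rewrite oner_eq0.
- move=> d; have /finite_seqP[s sE] := dual_part_finite d.
  rewrite (_ : d = \sum_(y <- undup s) e y).
    by apply: span_sum => y _; apply: sub_span; exists y.
  apply/eqP; rewrite -subr_eq0; apply/eqP; apply: dual_part_inj => y.
  have opp d' : dual_part (- d') y = dual_part d' y.
    by apply: (addrI (dual_part d' y)); rewrite -dual_partD subrr dual_part0 F2_addxx.
  rewrite dual_partD opp.
  rewrite (big_morph (dual_part^~ y) (fun d d' => dual_partD d d' y) (dual_part0 y)).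
  under eq_bigr do rewrite eP.
  have yE : [set` s] y <-> dual_part d y <> 0 by rewrite -sE.
  have [ys|ys] := boolP (y \in s).
    rewrite (bigD1_seq y) ?mem_undup ?undup_uniq //= eqxx big1 ?addr0.
      by move/yE: ys => /F2_neq0 ->; rewrite F2_addxx.
    by move=> z; rewrite eq_sym => /negbTE ->.
  rewrite big1_seq ?addr0.
    by apply: contrapT => /yE /= ys'; rewrite ys' in ys.
  move=> z /andP[_]; rewrite mem_undup => zs; case: eqP => // yz.
  by rewrite yz zs in ys.
Qed.

End QuasiBooleanCohomology.

(** * The spectrum *)

Section SpectrumPoints.
Variables (B : booleanRingType) (X : topologicalType) (psi : B -> X -> 'F_2).
Hypothesis psiD : forall b c x, psi (b + c) x = psi b x + psi c x.
Hypothesis psiM : forall b c x, psi (b * c) x = psi b x * psi c x.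
Hypothesis psi_inj : forall b, (forall x, psi b x = 0) -> b = 0.
Hypothesis psi_continuous : forall b,
  continuous (psi b : X -> discrete_topology 'F_2).
Hypothesis psi_surj : forall g : X -> 'F_2,
  continuous (g : X -> discrete_topology 'F_2) -> exists b, psi b =1 g.

(** Preservation of 1 is not assumed; it follows from multiplicativity and from a preimage of the
    constant function 1. *)
Lemma psi1 x : psi 1 x = 1.
Proof.
have [b e] := psi_surj (@cst_continuous X (discrete_topology 'F_2) 1).
by have := psiM 1 b x; rewrite mul1r !e mulr1 => <-.
Qed.

Lemma psi0 x : psi 0 x = 0.
Proof. by apply: (addrI (psi 0 x)); rewrite -psiD !addr0. Qed.

(** This is the kernel of evaluation at [x]; it is prime because ['F_2] has no zero divisors. *)
Definition point (x : X) : spectrum B.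
Proof.
exists [set b | psi b x = 0] => /= [|b c b0 c0|b c c0||b c].
- exact: psi0.
- by rewrite psiD b0 c0 addr0.
- by rewrite psiM c0 mulr0.
- by rewrite psi1; apply/eqP; rewrite oner_eq0.
- by rewrite psiM => /eqP; rewrite mulf_eq0 => /orP[] /eqP ->; [left|right].
Defined.

Lemma basic_openP (U : set (spectrum B)) : open U <->
  forall q, U q -> exists2 b, ~ prime_set q b & [set r | ~ prime_set r b] `<=` U.
Proof.
split=> [[E _ <-] q nE|h].
  have [b Eb nb] : exists2 b, E b & ~ prime_set q b.
    apply: contrapT => h; apply: nE => b Eb.
    by apply: contrapT => nb; apply: h; exists b.
  by exists b => // r rb /(_ b Eb).
exists [set b | [set r | ~ prime_set r b] `<=` U] => //; apply/seteqP; split=> q.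
  move=> nq; apply: contrapT => nU; apply: nq => b /= bU.
  by apply: contrapT => nb; apply: nU; apply: bU.
by move=> /h[b nb bU] /(_ b bU).
Qed.

Lemma point_continuous : continuous point.
Proof.
apply/continuousP => U /basic_openP oU; rewrite openE => x /= /oU[b bx bU].
have /continuous_discreteP c := @psi_continuous b.
apply: filterS (open_nbhs_nbhs (conj (c (psi b x)) erefl)) => y /= yx.
by apply: bU; rewrite /= yx.
Qed.

(** A nonempty principal open set comes from some [b] other than 0, and by injectivity [psi b] is
    nonzero at some [x]. *)
Lemma point_dense (U : set (spectrum B)) q : open U -> U q -> exists x, U (point x).
Proof.
move=> /basic_openP oU /oU[b bq bU]; apply: contrapT => h; apply: bq.
rewrite (_ : b = 0); first exact: prime0.
apply: psi_inj => x; apply: contrapT => bx; apply: h; exists x; exact: bU.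
Qed.

Lemma point_ext (P : choiceType) (u v : spectrum B -> P) :
  continuous (u : spectrum B -> discrete_topology P) ->
  continuous (v : spectrum B -> discrete_topology P) ->
  u \o point =1 v \o point -> u =1 v.
Proof.
move=> /continuous_discreteP uc /continuous_discreteP vc e q.
have [x [/= <- <-]] := point_dense (openI (uc (u q)) (vc (v q))) (conj erefl erefl).
exact: e.
Qed.

(** The indicators of the fibres of [g] come from orthogonal idempotents [e a] of sum 1. Each prime
    ideal misses exactly one of them, and [u] sends the prime to the index of that one. *)
Lemma point_factor (P : choiceType) (g : X -> P) : finite_set [set: P] ->
  continuous (g : X -> discrete_topology P) ->
  exists2 u : spectrum B -> P, continuous (u : spectrum B -> discrete_topology P) &
    u \o point =1 g.
Proof.
move=> /finite_seqP[s sP] gc.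
have /choice[e eP] a : exists b : B, psi b =1 fun x => (g x == a)%:R.
  apply: psi_surj.
  apply: (@continuous_discrete_op _ _ _ _
    (fun y a => (y == a)%:R : 'F_2) g (fun=> a)) => //.
  exact: cst_continuous.
have e_orth a a' : a != a' -> e a * e a' = 0.
  move=> aa; apply: psi_inj => x; rewrite psiM !eP.
  by have [->|_] := eqVneq (g x) a; rewrite ?(negbTE aa) ?mul0r ?mulr0.
have e_sum : \sum_(a <- undup s) e a = 1.
  apply/eqP; rewrite -subr_eq0; apply/eqP; apply: psi_inj => x.
  have psi_opp b : psi (- b) x = - psi b x.
    by apply: (addrI (psi b x)); rewrite -psiD !subrr psi0.
  rewrite psiD psi_opp psi1 (big_morph _ (fun b c => psiD b c x) (psi0 x)).
  under eq_bigr do rewrite eP.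
  rewrite (bigD1_seq (g x)) ?undup_uniq //=; last first.
    by rewrite mem_undup; have : [set: P] (g x) by []; rewrite sP.
  rewrite eqxx big1 ?addr0 ?subrr // => a; rewrite eq_sym => /negbTE ->.
  by [].
have /choice[u uP] (q : spectrum B) : exists a, ~ prime_set q (e a).
  apply: contrapT => h; apply: (@prime1 _ q); rewrite -e_sum.
  elim/big_ind: _ => [||a _]; [exact: prime0|exact: primeD|].
  by apply: contrapT => na; apply: h; exists a.
have uE q a : ~ prime_set q (e a) -> u q = a.
  move=> nq; apply/eqP/negPn/negP => ua.
  have : prime_set q (e (u q) * e a) by rewrite e_orth //; exact: prime0.
  by move=> /prime_prime[/uP|/nq].
exists u.
  apply/continuous_discreteP => a; apply/basic_openP => q /= qa.
  exists (e a); first by rewrite -qa; exact: uP.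
  by move=> r /= /uE.
by move=> x /=; apply: uE; rewrite /= eP eqxx; apply/eqP; rewrite oner_eq0.
Qed.

(** Continuous maps to a finite discrete set are the same on [X] and on the spectrum: [point_factor]
    gives existence and [point_ext] uniqueness. *)
Lemma free_on_spectrum (G : topGroupType) (Y Y' : Type) (t : Y' -> Y)
    (i : Y -> G) (j : spectrum B -> G) : bijective t -> free_on i j ->
  free_on (i \o t) (j \o point).
Proof.
move=> [t' tK tK'] [ic jc j2 ijl iju]; split.
- move=> U U1; apply: (@finite_preimage _ _ [set y | ~ U (i y)] t).
    by move=> x y _ _; exact: (can_inj tK).
  exact: ic.
- by move=> x; apply: continuous_comp; [exact: point_continuous|exact: jc].
- by move=> x; exact: j2.
- move=> P f g P2 f1 gc g2.
  have [fin _] := (two_groupP P).1 P2.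
  have [u uc ug] := point_factor fin gc.
  have [||h [hh hi hj]] := ijl P (f \o t') u P2 _ uc.
  + apply: (@finite_preimage _ _ [set y | f y <> 1%g] t') => //.
    by move=> x y _ _; exact: (can_inj tK').
  (* The relation [u q * u q = 1] is known only at the points coming from [X], and extends by
     density. *)
  + apply: (@point_ext _ (fun q => u q * u q)%g (fun=> 1%g)).
    * exact: (@continuous_discrete_op _ _ _ _ (fun a b : P => a * b)%g u u).
    * exact: cst_continuous.
    * by move=> x /=; rewrite (ug x : u (point x) = _).
  exists h; split=> // z; last by rewrite -ug; exact: hj.
  by rewrite /= (hi _ : h (i (t z)) = _) /= tK.
- move=> P h h' P2 hh hh' ei ej; apply: (iju P) => //.
    by move=> y; have := ei (t' y); rewrite /= tK'.
  by apply: point_ext => //; exact: discrete_hom_comp_continuous.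
Qed.

End SpectrumPoints.

(** * The main theorem *)

Theorem theorem1p9 (G : topGroupType) (D : gradedAlg) (B : booleanRingType)
    (Y : set (D 1%N)) :
  is_quasi_boolean G ->
  dual_alg D ->
  graded_iso (cohomology_alg G) (connected_sum D (graded_boolean B)) ->
  is_basis Y ->
  top_isog G (free_pro2_product (free_pro2 Y) (boolean_pro2 (spectrum B))).
Proof.
move=> [_ [F [B' [[Y' isoF] [_ [X' isoB]] isoG]]]] [_ D0] [f [fbij _ fmul]] Yb.
have [iF hF] := free_on_set_isog isoF (@free_pro2P Y').
have [jB hB] := free_on_space_isog isoB (@boolean_pro2P X').
have h1 := free_on_product hF hB.
have [i [j ij]] := free_on_isog isoG h1.
have [phi' phiK phiK'] := fbij 1%N.
pose phi : cohomology G 1 -> D 1%N * B := f 1%N.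
have phi'D : {morph phi' : p q / p + q}.
  by move=> p q; apply: (can_inj phiK); rewrite phiK' linearD !phiK'.
have cup_phi (a b c d : cohomology G 1) :
    cup a b = cup c d <-> (phi a).2 * (phi b).2 = (phi c).2 * (phi d).2.
  (* In degree 2 the component in [D] vanishes, so a product depends only on the components in
     [B]. *)
  have cupE (u v : cohomology G 1) :
      f (1 + 1)%N (cup u v) = (0, (phi u).2 * (phi v).2).
    rewrite (fmul 1%N 1%N u v).
    rewrite -[LHS]/(gmul (phi u).1 (phi v).1, (phi u).2 * (phi v).2).
    by congr (_, _); exact: D0.
  split=> [e|e]; first by have := cupE a b; rewrite e cupE => -[].
  by apply: (bij_inj (fbij (1 + 1)%N)); rewrite !cupE e.
have [e [ei el es]] := dual_basis ij phiK phiK' phi'D cup_phi.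
have [t tb] := basis_bijection ei el es Yb.
have h2 := free_on_product (@free_pro2P Y) (@boolean_pro2P (spectrum B)).
have bD := boolean_partD j phi'D.
have bM := boolean_partM ij phiK phiK' phi'D cup_phi.
have bI := boolean_part_inj ij phiK' phi'D cup_phi.
have bC b := @boolean_part_continuous _ _ _ _ _ ij _ _ phi' b.
have bS := boolean_part_surj ij phiK phiK' phi'D cup_phi.
(* The target group, free on [Y] and the spectrum of [B], is now also free on [Y'] and [X']. *)
have h3 := free_on_spectrum bD bM bI bC bS tb h2.
(* Uniqueness concerns completions, so it is applied to the free product of [F] and [B'], to which
   [G] is isomorphic. *)
apply: top_isog_trans isoG _; apply: free_on_unique h1 h3.
  by move=> N [].
by move=> N [].
Qed.
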